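(* Let $l$ be a closed curve in the plane $\mathbb{R}^2$. Take points $A_1,A_2,A_3$ on $l$ that split $l$ into paths $l_1,l_2,l_3$, where $A_i\notin l_i$ for each $i\in\{1,2,3\}$. Let $O$ and $O'$ be points in the plane such that $O,O'\notin l$. For each $i\in\{1,2,3\}$ let $OA_i$ and $O'A_i$ be arcs in the plane (not necessarily line segments) joining $A_i$ to $O$ and to $O'$, respectively. Assume that (1) for each $i\in\{1,2,3\}$ the union of the arcs $OA_i$ and $O'A_i$ is disjoint from $l_i$; (2) for each distinct $i,j\in\{1,2,3\}$ the arcs $OA_i$ and $O'A_j$ are disjoint. Then $w(l,O)-w(l,O')=\pm 1$, i.e. this integer is equal to $1$ or to $-1$.
   Context: A closed curve is a continuous map $\gamma\colon S^1\to\mathbb{R}^2$; it need not be injective. For a point $A\in\mathbb{R}^2\setminus\gamma(S^1)$, $w(\gamma,A)\in\mathbb{Z}$ denotes the winding number of $\gamma$ around $A$. The points $A_1,A_2,A_3$ splitting $l$ into $l_1,l_2,l_3$ means that $A_1,A_2,A_3$ are the images of three points of $S^1$ that divide the circle into three closed arcs, and $l_1,l_2,l_3$ are the restrictions of $l$ to these three arcs, numbered so that $l_i$ joins the two points $A_j$, $j\neq i$. In expressions such as $A_i\notin l_i$, $O\notin l$, or ''disjoint from $l_i$'', curves and paths are identified with their images. *)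

(* Defs.v *)
From HB Require Import structures.
From mathcomp Require Import all_boot all_order all_algebra.
From mathcomp Require Import all_classical all_reals all_analysis.
Import Order.TTheory GRing.Theory Num.Theory.
Import numFieldNormedType.Exports.

Set Implicit Arguments.
Unset Strict Implicit.
Unset Printing Implicit Defensive.

Local Open Scope classical_set_scope.
Local Open Scope ring_scope.

(* Points of the plane are pairs: the product topology on R * R is the usual
   one, but its library norm is the max norm and is therefore avoided below. *)
Definition unit_circle (R : realType) : set (R * R) :=
  [set z | z.1 ^+ 2 + z.2 ^+ 2 = 1].
Arguments unit_circle : clear implicits.

Definition expi (R : realType) (t : R) : R * R := (cos t, sin t).

(* Only the values of l on the unit circle matter. *)
Definition closed_curve (R : realType) (l : R * R -> R * R) : Prop :=
  {within unit_circle R, continuous l}.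

(* th is a continuous determination of the angle of the vector from A to
   l (expi t) for t in [0, 2 pi], and n is its total variation in turns. *)
Definition has_winding_number (R : realType) (l : R * R -> R * R) (A : R * R)
    (n : int) : Prop :=
  exists th : R -> R,
    [/\ {within `[0, 2 * pi], continuous th},
        (forall t, t \in `[0, 2 * pi] ->
           exists r : R, 0 < r /\
             l (expi t) = (A.1 + r * cos (th t), A.2 + r * sin (th t)))
      & th (2 * pi) - th 0 = 2 * pi * n%:~R].

(* For a closed curve l avoiding A there is exactly one such integer; the
   default value 0 is irrelevant in that case. *)
Definition winding_number (R : realType) (l : R * R -> R * R) (A : R * R) : int :=
  xget 0 [set n | has_winding_number l A n].

(* The closed arcs c i cover the circle, c i has the two points p j (j != i)
   as endpoints, and two different arcs meet only in their common endpoint.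
   Both cyclic orders of p 0, p 1, p 2 are allowed. *)
Definition splits_circle (R : realType) (p : 'I_3 -> R * R)
    (c : 'I_3 -> set (R * R)) : Prop :=
  [/\ (forall i, exists s t : R,
         [/\ s < t, t < s + 2 * pi,
             c i = @expi R @` `[s, t]
           & [set expi s; expi t] = [set p j | j in [set j | j != i]]]),
      \bigcup_i c i = unit_circle R
    & (forall i j k, i != j -> j != k -> k != i -> c i `&` c j = [set p k])].

Definition is_arc (R : realType) (S : set (R * R)) (P Q : R * R) : Prop :=
  exists f : R -> R * R,
    [/\ {within `[0, 1], continuous f},
        {in `[0, 1] &, injective f},
        f 0 = P, f 1 = Q
      & S = f @` `[0, 1]].

(* Main.v *)
Require Import Defs.
From HB Require Import structures.
From mathcomp Require Import all_boot all_order all_algebra.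
From mathcomp Require Import all_classical all_reals all_analysis.
From mathcomp Require Import ring lra zify.
Import Order.TTheory GRing.Theory Num.Theory.
Import numFieldNormedType.Exports.

Set Implicit Arguments.
Unset Strict Implicit.
Unset Printing Implicit Defensive.

Local Open Scope classical_set_scope.
Local Open Scope ring_scope.

(** The idea is to work in the infinite cyclic covering of the plane punctured at
    [O] and [O'], in which a point [z] is described by the logarithm of
    [(z - O) / (z - O')]. The covering is again a plane, and its deck
    transformations are the vertical translations by multiples of [2 * pi]. The
    curve [l] lifts to a path whose end is its start translated by [D] periods,
    where [D = w(l, O) - w(l, O')]. For each [i], the arc from [O] to [A_i]
    followed by the arc from [A_i] to [O'] lifts to a line [X_i] from the far left
    to the far right. Since these arcs are disjoint from [l_i], the lift of [l_i]
    avoids all the translates of [X_i]. Since the arcs [OA_i] and [O'A_j] are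
    disjoint for distinct [i] and [j], the left half of [X_i] avoids the right half
    of every translate of [X_j].

    A point [P] off such a line [X] is called above or below it according to the
    sign of the total turn of the vector from [X s] to [P], when [s] runs along the
    line. The line may be far from simple, and this total turn may be several
    half-turns, but its sign already behaves well:
    - it does not change when [P] moves without meeting [X] ([above_move]);
    - [A_j] is above [X_i] if and only if [A_i] is below [X_j] ([above_below]):
      the angle of [X_j t - X_i s] is a continuous function on the pairs of
      parameters of opposite signs, and both turns are read off it;
    - there are no three lines with the second above the first, the third above
      the second and the first above the third ([not_cyclic]). This is the heart of
      the matter. The triples of parameters with median zero form a topological
      plane, on which the angles of the three differences of the points on the
      lines are defined. If the lines were in cyclic position, the behaviour of the
      angles at infinity would force the three of them to agree somewhere
      ([poincare_miranda]), while three vectors that add up to zero cannot have the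
      same direction.

    Let [G k] mean that the translate of [A_2] by [k] periods is above [X_1]. The
    first two facts give that [G (k - D)] holds exactly when [G (- k)] does not,
    and the third one that [G] and its complement are closed under addition. As
    [G k] holds for large [k] and fails for large negative [k], it follows that [D]
    is [1] or [-1] ([sign_cut], [deck_shift]).

    The analytic input is the existence of continuous angles on star-shaped compact
    sets ([angle_lift]), for which there is an explicit formula. *)

(** * Continuity of formulas *)

Section Continuity.
Context {R : realType} {T : topologicalType}.
Implicit Types f g : T -> R.

Lemma cst_cont (U : topologicalType) (c : U) : continuous (fun _ : T => c).
Proof. by move=> x; exact: cvg_cst. Qed.

Lemma add_cont f g : continuous f -> continuous g ->
  continuous (fun x => f x + g x).
Proof. by move=> cf cg x; apply: cvgD; [exact: cf|exact: cg]. Qed.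

Lemma opp_cont f : continuous f -> continuous (fun x => - f x).
Proof. by move=> cf x; apply: cvgN; exact: cf. Qed.

Lemma mul_cont f g : continuous f -> continuous g ->
  continuous (fun x => f x * g x).
Proof. by move=> cf cg x; apply: cvgM; [exact: cf|exact: cg]. Qed.

Lemma sqr_cont f : continuous f -> continuous (fun x => f x ^+ 2).
Proof. by move=> cf; exact: mul_cont. Qed.

Lemma div_cont f g : continuous f -> continuous g -> (forall x, g x != 0) ->
  continuous (fun x => f x / g x).
Proof.
by move=> cf cg g0; apply: mul_cont => // x; apply: cvgV; [exact: g0|exact: cg].
Qed.

Lemma max_cont f g : continuous f -> continuous g ->
  continuous (fun x => Num.max (f x) (g x)).
Proof. by move=> cf cg x; apply: continuous_max; [exact: cf|exact: cg]. Qed.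

Lemma min_cont f g : continuous f -> continuous g ->
  continuous (fun x => Num.min (f x) (g x)).
Proof. by move=> cf cg x; apply: continuous_min; [exact: cf|exact: cg]. Qed.

Lemma comp_cont (U V : topologicalType) (f : T -> U) (g : U -> V) :
  continuous f -> continuous g -> continuous (fun x => g (f x)).
Proof. by move=> cf cg x; apply: continuous_comp; [exact: cf|exact: cg]. Qed.

Lemma pair_cont (U V : topologicalType) (f : T -> U) (g : T -> V) :
  continuous f -> continuous g -> continuous (fun x => (f x, g x)).
Proof. by move=> cf cg x; apply: cvg_pair; [exact: cf|exact: cg]. Qed.

Lemma fst_cont (U V : topologicalType) (f : T -> U * V) :
  continuous f -> continuous (fun x => (f x).1).
Proof. by move=> cf; apply: (@comp_cont _ U f) => // x; exact: cvg_fst. Qed.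

Lemma snd_cont (U V : topologicalType) (f : T -> U * V) :
  continuous f -> continuous (fun x => (f x).2).
Proof. by move=> cf; apply: (@comp_cont _ V f) => // x; exact: cvg_snd. Qed.

Lemma sum_cont (F : nat -> T -> R) (n : nat) : (forall k, continuous (F k)) ->
  continuous (fun x => \sum_(k < n) F k x).
Proof.
move=> cF; elim: n => [|n IHn].
  under eq_fun do rewrite big_ord0; exact: cst_cont.
under eq_fun do rewrite big_ord_recr /=; exact: add_cont.
Qed.

End Continuity.

Lemma id_cont (T : topologicalType) : continuous (fun x : T => x).
Proof. by move=> x; exact: cvg_id. Qed.

(** Dispatches on the head of the formula, which spares higher-order unification
    with all the lemmas above. *)
Ltac cont :=
  lazymatch goal with
  | |- continuous (fun x => x) => exact: id_cont
  | |- continuous (fun x => @?f x + @?g x) => apply: (@add_cont _ _ f g); cont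
  | |- continuous (fun x => - @?f x) => apply: (@opp_cont _ _ f); cont
  | |- continuous (fun x => @?f x * @?g x) => apply: (@mul_cont _ _ f g); cont
  | |- continuous (fun x => @?f x ^+ 2) => apply: (@sqr_cont _ _ f); cont
  | |- continuous (fun x => Num.max (@?f x) (@?g x)) =>
      apply: (@max_cont _ _ f g); cont
  | |- continuous (fun x => Num.min (@?f x) (@?g x)) =>
      apply: (@min_cont _ _ f g); cont
  | |- continuous (fun x => (@?f x, @?g x)) =>
      apply: (@pair_cont _ _ _ f g); cont
  | |- continuous (fun x => (@?f x).1) => apply: (@fst_cont _ _ _ f); cont
  | |- continuous (fun x => (@?f x).2) => apply: (@snd_cont _ _ _ f); cont
  | |- continuous fst => exact: (fst_cont (@id_cont _))
  | |- continuous snd => exact: (snd_cont (@id_cont _))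
  | _ => first [assumption | exact: cst_cont | idtac]
  end.

(** * Clamping *)

Section Clamp.
Context {R : realType}.

Definition clamp (a b t : R) : R := Num.max a (Num.min b t).

Lemma clamp_cont (a b : R) : continuous (clamp a b).
Proof. by rewrite /clamp; cont. Qed.

Lemma clamp_itv (a b t : R) : a <= b -> a <= clamp a b t <= b.
Proof.
move=> ab; rewrite /clamp le_max lexx /= ge_max ab /=.
by rewrite ge_min lexx.
Qed.

Lemma clamp_id (a b t : R) : a <= t <= b -> clamp a b t = t.
Proof.
by case/andP=> at_ tb; rewrite /clamp (min_idPr tb) (max_idPr at_).
Qed.

Lemma clamp_ge (a b t : R) : a <= b -> b <= t -> clamp a b t = b.
Proof. by move=> ab bt; rewrite /clamp (min_idPl bt) (max_idPr ab). Qed.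

Lemma clamp_le (a b t : R) : a <= b -> t <= a -> clamp a b t = a.
Proof.
move=> ab ta; rewrite /clamp (min_idPr (le_trans ta ab)).
exact/max_idPl.
Qed.

(** Precomposing with a clamp turns continuity relative to a segment into
    continuity everywhere. *)
Lemma within_clamp_cont (U : topologicalType) (f : R -> U) (a b : R) :
  a <= b -> {within `[a, b], continuous f} ->
  continuous (fun t => f (clamp a b t)).
Proof.
move=> ab /subspace_continuousP cf t.
have ct : `[a, b]%classic (clamp a b t) by rewrite /= in_itv /= clamp_itv.
move=> W nW; have nW' := cf _ ct W nW.
change (nbhs t (fun s => W (f (clamp a b s)))).
have H := @clamp_cont a b t _ nW'.
refine (@filterS _ (nbhs t) _ _ _ _ H) => s; apply.
by rewrite /= in_itv /= clamp_itv.
Qed.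

Lemma stays_below (f : R -> R) (a b c : R) :
  a <= b -> {within `[a, b], continuous f} ->
  (forall t, a <= t <= b -> f t <> c) -> f a < c -> f b < c.
Proof.
move=> ab cf fc fac; rewrite ltNge; apply/negP => cfb.
have [|t] := IVT (v := c) ab cf.
  by rewrite ge_min (ltW fac) /= le_max cfb orbT.
by rewrite in_itv /= => tab; exact: fc.
Qed.

Lemma stays_above (f : R -> R) (a b c : R) :
  a <= b -> {within `[a, b], continuous f} ->
  (forall t, a <= t <= b -> f t <> c) -> c < f a -> c < f b.
Proof.
move=> ab cf fc fac; rewrite ltNge; apply/negP => cfb.
have [|t] := IVT (v := c) ab cf.
  by rewrite ge_min cfb orbT /= le_max (ltW fac).
by rewrite in_itv /= => tab; exact: fc.
Qed.

End Clamp.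

(** * Angles of plane vectors *)

Section Angle.
Context {R : realType}.
Implicit Types (u v w : R * R) (a b t : R).

Definition angle_of (t : R) (v : R * R) : Prop :=
  exists r : R, [/\ 0 < r, v.1 = r * cos t & v.2 = r * sin t].

Definition dot v w : R := v.1 * w.1 + v.2 * w.2.
Definition cross v w : R := v.1 * w.2 - v.2 * w.1.

Lemma pi_half_gt0 : 0 < pi / 2 :> R.
Proof. by rewrite divr_gt0 ?pi_gt0. Qed.

Lemma angle_cos_gt0 t v : angle_of t v -> (0 < cos t) = (0 < v.1).
Proof. by case=> r [r0 -> _]; rewrite (pmulr_rgt0 _ r0). Qed.

Lemma angle_cos_lt0 t v : angle_of t v -> (cos t < 0) = (v.1 < 0).
Proof. by case=> r [r0 -> _]; rewrite (pmulr_rlt0 _ r0). Qed.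

Lemma angle_sin_gt0 t v : angle_of t v -> (0 < sin t) = (0 < v.2).
Proof. by case=> r [r0 _ ->]; rewrite (pmulr_rgt0 _ r0). Qed.

Lemma angle_sin_lt0 t v : angle_of t v -> (sin t < 0) = (v.2 < 0).
Proof. by case=> r [r0 _ ->]; rewrite (pmulr_rlt0 _ r0). Qed.

Lemma angleDpi t v : angle_of t v -> angle_of (t + pi) (- v).
Proof.
case=> r [r0 v1 v2]; exists r; split=> //=.
  by rewrite cosDpi v1 mulrN.
by rewrite sinDpi v2 mulrN.
Qed.

Lemma angleBpi t v : angle_of t v -> angle_of (t - pi) (- v).
Proof.
case=> r [r0 v1 v2]; exists r; split=> //=.
  by rewrite cosB cospi sinpi v1; ring.
by rewrite sinB cospi sinpi v2; ring.
Qed.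

Lemma angle_conj t v : angle_of t v -> angle_of (- t) (v.1, - v.2).
Proof. by case=> r [r0 v1 v2]; exists r; rewrite cosN sinN v1 v2 mulrN. Qed.

Lemma dot_gt0 v : v <> 0 -> 0 < dot v v.
Proof.
move=> v0; rewrite /dot -!expr2 lt0r addr_ge0 ?sqr_ge0 // andbT.
apply/negP => /eqP; move/eqP; rewrite paddr_eq0 ?sqr_ge0 // !sqrf_eq0.
by case/andP=> /eqP v1 /eqP v2; apply: v0; rewrite [v]surjective_pairing v1 v2.
Qed.

Lemma angle_neq0 t v : angle_of t v -> v <> 0.
Proof.
case=> r [r0 v1 v2] v0; have := cos2Dsin2 t.
have /eqP : r * cos t = 0 by rewrite -v1 v0.
have /eqP : r * sin t = 0 by rewrite -v2 v0.
rewrite !mulf_eq0 (gt_eqF r0) /= => /eqP -> /eqP ->.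
by rewrite expr0n addr0 => /eqP; rewrite eq_sym oner_eq0.
Qed.

Lemma atan_cos_gt0 (x : R) : 0 < cos (atan x).
Proof. by apply: cos_gt0_pihalf; rewrite atan_gtNpi2 atan_ltpi2. Qed.

Lemma sin_atanE (x : R) : sin (atan x) = x * cos (atan x).
Proof.
have c0 : cos (atan x) != 0 by rewrite gt_eqF ?atan_cos_gt0.
by have := @atanK R x; rewrite /tan => {2}<-; rewrite divfK.
Qed.

(** When the scalar product is positive, the turn from [v] to [w] is less than a
    right angle, so it is the arctangent of an expression that is continuous in
    [v] and [w]. *)
Lemma angle_turn t v w : angle_of t v -> 0 < dot v w ->
  angle_of (t + atan (cross v w / dot v w)) w.
Proof.
move=> av d0; have v0 := angle_neq0 av; have n0 := dot_gt0 v0.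
case: av => r [r0 v1 v2].
set x := cross v w / dot v w; have c0 := atan_cos_gt0 x.
have xd : x * dot v w = cross v w by rewrite /x divfK // gt_eqF.
have r2 : dot v v = r ^+ 2.
  by rewrite /dot v1 v2 -[RHS]mulr1 -(cos2Dsin2 t); ring.
exists (dot v w / (r * cos (atan x))); split.
- by rewrite divr_gt0 // mulr_gt0.
- rewrite cosD sin_atanE.
  have -> : dot v w / (r * cos (atan x)) *
    (cos t * cos (atan x) - sin t * (x * cos (atan x))) =
    (dot v w * (r * cos t) - (x * dot v w) * (r * sin t)) / (r ^+ 2).
    by field; rewrite !gt_eqF.
  rewrite xd -v1 -v2 -r2; apply: (mulIf (lt0r_neq0 n0)).
  by rewrite divfK ?gt_eqF // /dot /cross; ring.
- rewrite sinD sin_atanE.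
  have -> : dot v w / (r * cos (atan x)) *
    (sin t * cos (atan x) + cos t * (x * cos (atan x))) =
    (dot v w * (r * sin t) + (x * dot v w) * (r * cos t)) / (r ^+ 2).
    by field; rewrite !gt_eqF.
  rewrite xd -v1 -v2 -r2; apply: (mulIf (lt0r_neq0 n0)).
  by rewrite divfK ?gt_eqF // /dot /cross; ring.
Qed.

Lemma angle_atan v : 0 < v.1 -> angle_of (atan (v.2 / v.1)) v.
Proof.
move=> v1; have a1 : angle_of 0 (1, 0) by exists 1; rewrite cos0 sin0 !mulr1 mulr0.
have := @angle_turn 0 (1, 0) v a1; rewrite /dot /cross /= !mul1r !mul0r addr0 subr0.
by rewrite add0r; apply.
Qed.

Lemma angle_exists v : v <> 0 -> exists t, angle_of t v.
Proof.
move=> v0; have [v1|v1|v1] := ltrgtP 0 v.1.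
- by exists (atan (v.2 / v.1)); exact: angle_atan.
- have := @angle_atan (- v); rewrite /= oppr_gt0 => /(_ v1)/angleDpi.
  by rewrite opprK; eexists; eassumption.
- have [v2|v2|v2] := ltrgtP 0 v.2.
  + by exists (pi / 2), v.2; rewrite cos_pihalf sin_pihalf -v1 mulr0 mulr1.
  + exists (- (pi / 2)), (- v.2).
    by rewrite cosN sinN cos_pihalf sin_pihalf -v1 mulr0 mulrNN mulr1 oppr_gt0.
  + by case: v0; rewrite [v]surjective_pairing -v1 -v2.
Qed.

Lemma cosD2piz (x : R) (k : int) : cos (x + 2 * pi * k%:~R) = cos x.
Proof.
have per (y : R) (n : nat) : cos (y + 2 * pi * n%:R) = cos y.
  rewrite mulrC !mulr_natl.
  exact: periodicn (@cosD2pi R) n y.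
case: k => n; first exact: per.
by rewrite -(per _ n.+1) NegzE mulrNz mulrN addrNK.
Qed.

Lemma sinD2piz (x : R) (k : int) : sin (x + 2 * pi * k%:~R) = sin x.
Proof. by rewrite -!cosBpihalf addrAC cosD2piz. Qed.

Lemma cos_eq1 (x : R) : cos x = 1 -> exists n : int, x = 2 * pi * n%:~R.
Proof.
move=> cx; have p0 : 0 < 2 * pi :> R by rewrite mulr_gt0 ?pi_gt0.
pose n := Num.floor (x / (2 * pi)); pose y := x - 2 * pi * n%:~R.
have /andP[y0 y2] : 0 <= y < 2 * pi.
  have := floor_itv (x / (2 * pi)); rewrite -/n => /andP[].
  rewrite ler_pdivlMr // ltr_pdivrMr // intrD /y; lra.
have cy : cos y = 1 by rewrite -(cosD2piz y n) /y subrK.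
suff y00 : y = 0 by exists n; apply/eqP; rewrite -subr_eq0 -/y y00.
apply/eqP; move: y0; rewrite le_eqVlt eq_sym => /orP[//|y0].
have ypi (z : R) : 0 < z <= pi -> cos z < 1.
  case/andP=> z0 zpi; rewrite -cos0 ltr_cos // in_itv /= ?pi_ge0 ?lexx //.
  by rewrite zpi ltW.
have [yp|yp] := leP y pi; first by have := ypi y; rewrite y0 yp cy ltxx => /(_ isT).
have := ypi (2 * pi - y).
have -> : cos (2 * pi - y) = cos y.
  by rewrite addrC -[2 * pi]mulr1 -(_ : (1%:Z)%:~R = 1) // cosD2piz cosN.
rewrite cy ltxx => H; exfalso; have /H// : 0 < 2 * pi - y <= pi.
by apply/andP; split; lra.
Qed.

(** The angles of a vector form one class modulo [2 * pi]; together with the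
    continuity of a difference of two determinations this makes total variations
    of the angle well defined. *)
Lemma angle_unique a b v : angle_of a v -> angle_of b v ->
  exists n : int, a - b = 2 * pi * n%:~R.
Proof.
move=> [r [r0 v1 v2]] [s [s0 w1 w2]].
have c1 : r * cos a = s * cos b by rewrite -v1.
have s1 : r * sin a = s * sin b by rewrite -v2.
have rs : r = s.
  have : r ^+ 2 = s ^+ 2.
    have -> : r ^+ 2 = (r * cos a) ^+ 2 + (r * sin a) ^+ 2.
      by rewrite -[LHS]mulr1 -(cos2Dsin2 a); ring.
    rewrite c1 s1 -[RHS]mulr1 -(cos2Dsin2 b); ring.
  by move/eqP; rewrite eqrXn2 ?ltW // => /eqP.
apply: cos_eq1; rewrite cosB -(cos2Dsin2 a) !expr2.
have -> : cos b = cos a by apply: (mulfI (lt0r_neq0 r0)); rewrite c1 rs.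
by have -> : sin b = sin a by apply: (mulfI (lt0r_neq0 r0)); rewrite s1 rs.
Qed.


(** The difference of the two determinations takes its values in the multiples
    of [2 * pi], and cannot pass from one to another without meeting the half
    integer multiple in between. *)
Lemma angle_unique_path (p q : R -> R) (v : R -> R * R) (a b : R) : a <= b ->
  {within `[a, b], continuous p} -> {within `[a, b], continuous q} ->
  (forall t, a <= t <= b -> angle_of (p t) (v t)) ->
  (forall t, a <= t <= b -> angle_of (q t) (v t)) ->
  p b - q b = p a - q a.
Proof.
move=> ab cp cq ap aq.
have cd : {within `[a, b], continuous (fun t => p t - q t)}.
  by apply: within_continuousB.
have dn t : a <= t <= b -> exists n : int, p t - q t = 2 * pi * n%:~R.
  by move=> tab; apply: angle_unique (ap t tab) (aq t tab).
have aab : a <= a <= b by rewrite lexx.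
have bab : a <= b <= b by rewrite lexx andbT.
have [m dm] := dn a aab; have [n dnb] := dn b bab.
have p0 : 0 < 2 * pi :> R by rewrite mulr_gt0 ?pi_gt0.
have half (k j : int) : 2 * pi * k%:~R = 2 * pi * (j%:~R + 1 / 2) :> R -> False.
  move/(mulfI (lt0r_neq0 p0)) => kj.
  have : (k * 2 - j * 2)%:~R = 1%:~R :> R.
    rewrite intrD mulrNz !intrM kj; lra.
  by move/intr_inj; lia.
have dc t (j : int) : a <= t <= b -> p t - q t <> 2 * pi * (j%:~R + 1 / 2).
  by move=> tab; have [k ->] := dn t tab => /half.
rewrite dm dnb; congr (_ * _%:~R).
have [mn|nm|//] := ltrgtP n m.
- have := @stays_above _ _ a b (2 * pi * (n%:~R + 1 / 2)) ab cd.
  rewrite dm dnb !ltr_pM2l // => H.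
  have : n%:~R + 1 / 2 < n%:~R :> R.
    apply: H => [t /dc|]; first exact.
    by have : (n + 1)%:~R <= m%:~R :> R; [rewrite ler_int; lia|rewrite intrD; lra].
  by move=> ?; exfalso; lra.
- have := @stays_below _ _ a b (2 * pi * (m%:~R + 1 / 2)) ab cd.
  rewrite dm dnb !ltr_pM2l // => H.
  have : n%:~R < m%:~R + 1 / 2 :> R.
    by apply: H => [t /dc|]; [exact|lra].
  move=> ?; exfalso.
  by have : (m + 1)%:~R <= n%:~R :> R; [rewrite ler_int; lia|rewrite intrD; lra].
Qed.

End Angle.

(** * Continuous determinations of the angle *)

Section Lift.
Context {R : realType}.
Implicit Types (q : R * R) (V : R * R -> R * R).

Definition scale (r : R) (q : R * R) : R * R := (r * q.1, r * q.2).

Lemma dot_cont (T : topologicalType) (f g : T -> R * R) :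
  continuous f -> continuous g -> continuous (fun x => dot (f x) (g x)).
Proof. by move=> cf cg; rewrite /dot; cont. Qed.

Lemma cross_cont (T : topologicalType) (f g : T -> R * R) :
  continuous f -> continuous g -> continuous (fun x => cross (f x) (g x)).
Proof. by move=> cf cg; rewrite /cross; cont. Qed.

(** On a compact set one mesh [1 / (n + 1)] makes all the turns along the radii
    less than a right angle. The same number bounds the scalar products from
    below. *)
Lemma small_turns V (K : set (R * R)) : continuous V -> compact K ->
  (forall q r, K q -> 0 <= r <= 1 -> K (scale r q)) ->
  (forall q, K q -> V q <> 0) ->
  exists n : nat, forall q (r : R), K q -> 0 <= r <= 1 ->
    n.+1%:R^-1 < dot (V (scale r q)) (V (scale (r + n.+1%:R^-1) q)).
Proof.
move=> cV cK star V0.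
pose D (x : (R * (R * R)) * R) : R :=
  dot (V (scale x.1.1 x.1.2)) (V (scale (x.1.1 + x.2) x.1.2)) - x.2.
have cD : continuous D.
  rewrite /D /scale. cont.
  apply: dot_cont; apply: (comp_cont _ cV). cont. cont.
have cI : compact ((`[0, 1]%classic : set R) `*` K).
  by apply: compact_setX => //; exact: segment_compact.
pose P (n : nat) (x : R * (R * R)) : Prop := 0 < D (x, n.+1%:R^-1).
have := (compact_near_coveringP _).1 cI nat \oo P _.
have H x : ((`[0, 1]%classic : set R) `*` K) x ->
    \forall x' \near x & i \near \oo, P i x'.
  case: x => r q [/= r01 Kq]; rewrite in_itv /= in r01.
  have D0 : 0 < D ((r, q), 0).
    by rewrite /D /= addr0 subr0; apply: dot_gt0; apply/V0/star.
  have nD : \forall y \near ((r, q), 0 : R), 0 < D y.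
    exact: (@cvgr_gt R _ _ _ D _ (cD ((r, q), 0)) 0 D0).
  have [[A B] /= [nA nB] AB] := nD.
  exists (A, [set n | B (n.+1%:R^-1)]) => /=.
    by split=> //; exact: (@cvg_harmonic R _ nB).
  by case=> x' n [/= Ax Bn]; apply: (AB (x', n.+1%:R^-1)).
move=> /(_ _ H) [n _ Hn]; exists n => q r Kq r01.
have := Hn n (leqnn n) (r, q); rewrite /P /D /= subr_gt0; apply.
by split=> //=; rewrite in_itv.
Qed.

(** The small turns between successive points of the segment from the origin
    to [q] add up to the angle at [q]. This is a formula, hence continuous in
    [q], as soon as one subdivision serves all [q]; the maximum with [1 / n]
    leaves its values on [K] unchanged and makes it continuous everywhere. *)
Theorem angle_lift V (K : set (R * R)) (t0 : R) :
  continuous V -> compact K ->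
  (forall q r, K q -> 0 <= r <= 1 -> K (scale r q)) ->
  (forall q, K q -> V q <> 0) -> angle_of t0 (V 0) ->
  exists th : R * R -> R, [/\ continuous th, th 0 = t0 &
    forall q, K q -> angle_of (th q) (V q)].
Proof.
move=> cV cK star V0 at0; have [n Hn] := small_turns cV cK star V0.
pose h : R := n.+1%:R^-1.
have h0 : 0 < h by rewrite invr_gt0 ltr0n.
pose W k q := V (scale (k%:R * h) q).
pose turn k q := atan (cross (W k q) (W k.+1 q) /
                       Num.max (dot (W k q) (W k.+1 q)) h).
pose th m q := t0 + \sum_(k < m) turn k q.
have cW k : continuous (W k) by apply: (comp_cont _ cV); rewrite /scale; cont.
have cturn k : continuous (turn k).
  apply: (comp_cont (g := @atan R)); last by move=> x; exact: continuous_atan.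
  apply: div_cont; first exact: cross_cont.
    apply: max_cont; [exact: dot_cont|exact: cst_cont].
  by move=> q; rewrite gt_eqF // lt_max h0 orbT.
exists (th n.+1); split.
- by apply: add_cont; [exact: cst_cont|exact: sum_cont].
- rewrite /th big1 ?addr0 // => k _; rewrite /turn.
  have W0 j : W j 0 = V 0 by rewrite /W /scale /= !mulr0.
  have -> : cross (W k 0) (W k.+1 0) = 0 by rewrite !W0 /cross mulrC subrr.
  by rewrite mul0r atan0.
move=> q Kq; have step m : (m <= n.+1)%N -> angle_of (th m q) (W m q).
  elim: m => [_|m IHm mn].
    by rewrite /th big_ord0 addr0 /W /scale !mul0r.
  rewrite /th big_ord_recr /= addrA.
  have hd : h < dot (W m q) (W m.+1 q).
    have := Hn q (m%:R * h) Kq; rewrite -/h.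
    have -> : m%:R * h + h = m.+1%:R * h by rewrite -[m.+1]addn1 natrD mulrDl mul1r.
    apply; rewrite mulr_ge0 ?ler0n ?(ltW h0) //=.
    by rewrite /h ler_pdivrMr ?ltr0n // mul1r ler_nat ltnW.
  rewrite /turn (max_idPl (ltW hd)); apply: angle_turn (lt_trans h0 hd).
  exact/IHm/ltnW.
have := step n.+1 (leqnn _); rewrite /W /h divff ?pnatr_eq0 //.
by rewrite /scale !mul1r -surjective_pairing.
Qed.

Lemma box_compact (a b c d : R) :
  compact [set q : R * R | a <= q.1 <= b /\ c <= q.2 <= d].
Proof.
have -> : [set q : R * R | a <= q.1 <= b /\ c <= q.2 <= d] =
    (`[a, b]%classic : set R) `*` (`[c, d]%classic : set R).
  by apply/seteqP; split=> q /=; rewrite !in_itv.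
by apply: compact_setX; exact: segment_compact.
Qed.

(** Typically [A] is an angle and [c] the angle of a direction that the vector
    does not take along the segment. *)
Lemma segment_below (A : R * R -> R) (p q : R * R) (c : R) : continuous A ->
  (forall t, 0 <= t <= 1 ->
    A (p.1 + t * (q.1 - p.1), p.2 + t * (q.2 - p.2)) <> c) ->
  A p < c -> A q < c.
Proof.
move=> cA Ac pc.
pose g t := A (p.1 + t * (q.1 - p.1), p.2 + t * (q.2 - p.2)).
have g0 : g 0 = A p by rewrite /g !mul0r !addr0 -surjective_pairing.
have g1 : g 1 = A q by rewrite /g !mul1r ![_ + (_ - _)]addrC !subrK -surjective_pairing.
rewrite -g1; apply: (@stays_below _ g 0 1) => //; last by rewrite g0.
by apply: continuous_subspaceT; apply: (comp_cont _ cA); cont.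
Qed.

Lemma segment_above (A : R * R -> R) (p q : R * R) (c : R) : continuous A ->
  (forall t, 0 <= t <= 1 ->
    A (p.1 + t * (q.1 - p.1), p.2 + t * (q.2 - p.2)) <> c) ->
  c < A p -> c < A q.
Proof.
move=> cA Ac pc; have := @segment_below (fun x => - A x) p q (- c).
rewrite !ltrN2; apply => //; first exact: opp_cont.
by move=> t t01 /oppr_inj; exact: Ac.
Qed.

End Lift.

(** * The two-dimensional intermediate value theorem *)

Section Miranda.
Context {R : realType}.

Lemma quarter_turn (c x : R) : c < x -> cos (x - c) < 0 -> c + pi / 2 < x.
Proof.
move=> cx; rewrite ltNge => /negP cn; rewrite ltNge; apply/negP => xc.
apply: cn; apply: cos_ge0_pihalf; apply/andP; split; last by rewrite lerBlDl.
by rewrite (@le_trans _ _ 0) ?subr_ge0 ?ltW // oppr_lt0 pi_half_gt0.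
Qed.

(** If there were no common zero, a continuous angle of [(f, g)] would be
    pushed up by a quarter turn along each side of the square, and would not
    return to its initial value. *)
Theorem poincare_miranda (f g : R * R -> R) (c : R) : 0 < c ->
  continuous f -> continuous g ->
  (forall t, 0 <= t <= c ->
    [/\ f (0, t) < 0, 0 < f (c, t), g (t, 0) < 0 & 0 < g (t, c)]) ->
  exists q : R * R, [/\ 0 <= q.1 <= c, 0 <= q.2 <= c, f q = 0 & g q = 0].
Proof.
move=> c0 cf cg fg; apply: contrapT => nz.
pose V q := (f q, g q); pose K := [set q : R * R | 0 <= q.1 <= c /\ 0 <= q.2 <= c].
have t0 : 0 <= (0 : R) <= c by apply/andP; split; lra.
have tc : 0 <= c <= c by apply/andP; split; lra.
have f0 : V 0 \in [pred v : R * R | (v.1 < 0) && (v.2 < 0)].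
  by have [fn _ gn _] := fg 0 t0; rewrite inE /= fn gn.
case/andP: f0 => /= f0 g0.
pose a := atan (g 0 / f 0) + pi.
have aV : angle_of a (V 0).
  have := @angle_atan _ (- V 0); rewrite /= oppr_gt0 => /(_ f0) /angleDpi.
  by rewrite opprK invrN mulrNN.
have V0 q : K q -> V q <> 0.
  by case=> q1 q2 [fq gq]; apply: nz; exists q.
have star q r : K q -> 0 <= r <= 1 -> K (scale r q).
  case=> /andP[q1 q1c] /andP[q2 q2c] /andP[r0 r1]; split=> /=.
    by rewrite mulr_ge0 //= (le_trans _ q1c) // ler_piMl.
  by rewrite mulr_ge0 //= (le_trans _ q2c) // ler_piMl.
have [th [cth th0 thV]] := angle_lift (pair_cont cf cg)
  (@box_compact R 0 c 0 c) star V0 aV.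
have thc q : K q -> [/\ (0 < cos (th q)) = (0 < f q), (cos (th q) < 0) = (f q < 0),
    (0 < sin (th q)) = (0 < g q) & (sin (th q) < 0) = (g q < 0)].
  move=> /thV aq; split; first exact: angle_cos_gt0 aq.
  - exact: angle_cos_lt0 aq.
  - exact: angle_sin_gt0 aq.
  - exact: angle_sin_lt0 aq.
have api : pi < th 0.
  rewrite th0 /a ltrDr -atan0; apply: lt_atan.
  by rewrite -mulrNN -invrN divr_gt0 ?oppr_gt0.
have a3 : th 0 < pi + pi / 2.
  by rewrite th0 /a addrC ltrD2l atan_ltpi2.
have bot : pi < th (c, 0).
  apply: (segment_above cth _ api) => t t01 /= E; rewrite !subr0 !add0r mulr0 in E.
  have tt : 0 <= t * c <= c.
    by case/andP: t01 => t0' t1; rewrite mulr_ge0 ?(ltW c0) //= ler_piMl ?(ltW c0).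
  have [_ _ gn _] := fg _ tt; have [_ _ _] := thc (t * c, 0) (conj tt t0).
  by rewrite gn E sinpi ltxx.
have br : pi + pi / 2 < th (c, 0).
  apply: quarter_turn => //; have [_ fp _ _] := fg 0 t0.
  have [cp _ _ _] := thc (c, 0) (conj tc t0).
  by rewrite cosB cospi sinpi mulr0 addr0 mulrN1 oppr_lt0 cp.
have right : pi + pi / 2 < th (c, c).
  apply: (segment_above cth _ br) => t t01 /= E.
  rewrite subrr mulr0 addr0 subr0 add0r in E.
  have tt : 0 <= t * c <= c.
    by case/andP: t01 => t0' t1; rewrite mulr_ge0 ?(ltW c0) //= ler_piMl ?(ltW c0).
  have [_ fp _ _] := fg _ tt; have [+ _ _ _] := thc (c, t * c) (conj tc tt).
  by rewrite fp E cosD cos_pihalf sinpi mulr0 mul0r subr0 ltxx.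
have tr : pi + pi / 2 + pi / 2 < th (c, c).
  apply: quarter_turn => //; have [_ _ _ gp] := fg c tc.
  have [_ _ sp _] := thc (c, c) (conj tc tc).
  rewrite gp in sp; rewrite cosB cosD sinD cospi sinpi cos_pihalf sin_pihalf.
  by lra.
have pp : pi + pi / 2 + pi / 2 = pi + pi :> R by rewrite -addrA -splitr.
have top : pi + pi / 2 + pi / 2 < th (0, c).
  apply: (segment_above cth _ tr) => t t01 /= E.
  rewrite subrr mulr0 addr0 sub0r in E.
  have tt : 0 <= c + t * - c <= c.
    case/andP: t01 => t0' t1; rewrite mulrN gerBl mulr_ge0 ?(ltW c0) // andbT.
    by rewrite subr_ge0 ler_piMl ?(ltW c0).
  have [_ _ _ gp] := fg _ tt; have [_ _ + _] := thc (c + t * - c, c) (conj tt tc).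
  by rewrite gp E pp sinD sinpi mul0r mulr0 addr0 ltxx.
have tl : pi + pi / 2 + pi / 2 + pi / 2 < th (0, c).
  apply: quarter_turn => //; have [fn _ _ _] := fg c tc.
  have [_ cn _ _] := thc (0, c) (conj t0 tc).
  by rewrite fn in cn; rewrite pp cosB cosD sinD cospi sinpi; lra.
have left : pi + pi / 2 + pi / 2 + pi / 2 < th (0, 0).
  apply: (segment_above cth _ tl) => t t01 /= E.
  rewrite subrr mulr0 addr0 sub0r in E.
  have tt : 0 <= c + t * - c <= c.
    case/andP: t01 => t0' t1; rewrite mulrN gerBl mulr_ge0 ?(ltW c0) // andbT.
    by rewrite subr_ge0 ler_piMl ?(ltW c0).
  have [fn _ _ _] := fg _ tt; have [_ + _ _] := thc (0, c + t * - c) (conj t0 tt).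
  by rewrite fn E cosD cos_pihalf pp sinD cospi sinpi; lra.
have := lt_trans left a3; rewrite -addrA ltNge lerDl.
by rewrite ltW // addr_gt0 // pi_half_gt0.
Qed.

End Miranda.

(** * Lines in the plane and the sides of a line *)

Section Lines.
Context {R : realType}.
Implicit Types (X Y Z : R -> R * R) (P v : R * R).

(** A line runs from the far left to the far right at unit speed, up to a bounded
    error, but it need not be simple. The explicit error [2] leaves room for
    coordinates in [0, 1] and for the parameter to differ from the coordinate by
    at most [1]; it makes [5] a parameter beyond which every line is to the left,
    respectively to the right, of all the points of the strip of half-width [2]. *)
Definition line X : Prop :=
  [/\ continuous X, forall s, `|(X s).1 - s| <= 2
    & exists b, forall s, `|(X s).2| <= b].

(** As [s] runs along a line, the direction from [X s] to [P] turns from the right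
    half-plane to the left one. It may do so by any odd number of half-turns,
    roughly, since [X] may have loops; [P] is above [X] when the total turn is
    positive. The angle at [5] is never in [[- pi / 2, pi / 2]], which is why
    comparing with [pi / 2] detects the sign. *)
Definition above X P : Prop := exists th : R -> R,
  [/\ continuous th, forall s, -5 <= s <= 5 -> angle_of (th s) (P - X s),
      th (-5) < pi / 2 & pi / 2 < th 5].

Definition mirror v : R * R := (v.1, - v.2).

(** Defined by reflection, so that facts about [above] transfer to [below]. *)
Definition below X P : Prop := above (fun s => mirror (X s)) (mirror P).

Lemma mirrorK : involutive mirror.
Proof. by case=> a b; rewrite /mirror /= opprK. Qed.

Lemma mirror_line X : line X -> line (fun s => mirror (X s)).
Proof.
case=> cX X1 [b X2]; split; [by rewrite /mirror; cont|exact: X1|].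
by exists b => s; rewrite /= normrN.
Qed.

Lemma below_mirror X P : below (fun s => mirror (X s)) (mirror P) = above X P.
Proof. by rewrite /below; congr above; [apply/funext => s|]; rewrite mirrorK. Qed.

Lemma belowP X P : (exists th : R -> R,
  [/\ continuous th, forall s, -5 <= s <= 5 -> angle_of (th s) (P - X s),
      - (pi / 2) < th (-5) & th 5 < - (pi / 2)]) <-> below X P.
Proof.
split=> -[th [cth ath lo hi]]; exists (fun s => - th s).
  split; [by cont| |by rewrite ltrNl|by rewrite ltrNr].
  move=> s /ath/angle_conj; congr angle_of; rewrite /mirror.
  by congr pair; rewrite /= opprD opprK.
split; [by cont| |by rewrite ltrN2|by rewrite ltrN2].
move=> s /ath/angle_conj; congr angle_of.
by rewrite /mirror [RHS]surjective_pairing; congr pair; rewrite /= opprD !opprK.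
Qed.

Lemma cos_gt0_neq (x : R) : 0 < cos x -> x <> pi / 2.
Proof. by move=> + E; rewrite E cos_pihalf ltxx. Qed.

Lemma cos_lt0_neq (x : R) : cos x < 0 -> x <> pi / 2.
Proof. by move=> + E; rewrite E cos_pihalf ltxx. Qed.

Lemma line_left X P s : line X -> `|P.1| <= 2 -> s <= -5 -> 0 < (P - X s).1.
Proof.
by case=> _ /(_ s) + _; rewrite !ler_norml /= => /andP[? ?] /andP[? ?] ?; lra.
Qed.

Lemma line_right X P s : line X -> `|P.1| <= 2 -> 5 <= s -> (P - X s).1 < 0.
Proof.
by case=> _ /(_ s) + _; rewrite !ler_norml /= => /andP[? ?] /andP[? ?] ?; lra.
Qed.

Lemma line_center X : line X -> `|(X 0).1| <= 2.
Proof. by case=> _ /(_ 0) + _; rewrite subr0. Qed.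

Lemma line_lt X Y s t : line X -> line Y -> 5 <= t - s -> 0 < (Y t - X s).1.
Proof.
case=> _ /(_ s) + _ [_ /(_ t) + _].
by rewrite !ler_norml /= => /andP[? ?] /andP[? ?] ?; lra.
Qed.

Lemma line_gt X Y s t : line X -> line Y -> 5 <= s - t -> (Y t - X s).1 < 0.
Proof.
case=> _ /(_ s) + _ [_ /(_ t) + _].
by rewrite !ler_norml /= => /andP[? ?] /andP[? ?] ?; lra.
Qed.

(** Normalize the angle to be in the open interval from [- pi / 2] to [pi / 2] at
    [-5], where [P] is to the right; at [5] its cosine is negative, so that it has
    left this interval through one end or the other. *)
Lemma above_or_below X P : line X -> `|P.1| <= 2 -> (forall s, P <> X s) ->
  above X P \/ below X P.
Proof.
move=> lX P1 PX; have [cX _ _] := lX.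
pose V (q : R * R) := P - X (q.1 - 5).
pose K := [set q : R * R | 0 <= q.1 <= 10 /\ 0 <= q.2 <= 0].
have cV : continuous V.
  have cXq : continuous (fun q : R * R => X (q.1 - 5)).
    by apply: (comp_cont _ cX); cont.
  move=> q; apply: cvgB; [exact: cvg_cst|exact: cXq].
have star q r : K q -> 0 <= r <= 1 -> K (scale r q).
  case=> /andP[? ?] /andP[? ?] /andP[? ?].
  by split=> /=; apply/andP; split; nra.
have V0 q : K q -> V q <> 0.
  by move=> _ /eqP; rewrite subr_eq0 => /eqP; exact: PX.
have V1 : 0 < (V 0).1 by apply: line_left => //=; lra.
have [th [cth th0 ath]] :=
  angle_lift cV (@box_compact R _ _ _ _) star V0 (angle_atan V1).
have a5 s : -5 <= s <= 5 -> angle_of (th (s + 5, 0)) (P - X s).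
  move=> /andP[s0 s5]; have /ath : K (s + 5, 0).
    by split; apply/andP; split=> /=; lra.
  by rewrite /V /= addrK.
have c5 : continuous (fun s : R => th (s + 5, 0)) by apply: (comp_cont _ cth); cont.
have thm : th (-5 + 5, 0) = th 0 by congr th; rewrite addNr.
have r5 : -5 <= (5 : R) <= 5 by apply/andP; split; lra.
have cn : cos (th (5 + 5, 0)) < 0.
  by rewrite (angle_cos_lt0 (a5 _ r5)); exact: line_right.
have [hi|hi] := ltP (pi / 2) (th (5 + 5, 0)).
  left; exists (fun s => th (s + 5, 0)); split=> //.
  by rewrite thm th0 atan_ltpi2.
right; apply/belowP; exists (fun s => th (s + 5, 0)); split=> //.
  by rewrite thm th0 atan_gtNpi2.
rewrite ltNge; apply/negP => lo; move: cn; rewrite ltNge.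
by rewrite cos_ge0_pihalf // lo hi.
Qed.

Lemma above_not_below X P : above X P -> ~ below X P.
Proof.
move=> [p [cp ap p0 p5]] /belowP[q [cq aq q0 q5]].
have m55 : (-5 : R) <= 5 by lra.
have := angle_unique_path m55 (continuous_subspaceT cp)
  (continuous_subspaceT cq) ap aq.
by have := pi_half_gt0 (R := R); lra.
Qed.

(** The angle of [lam t - X s] lifts to the rectangle of all [(s, t)]. On the
    sides [s = -5] and [s = 5] the horizontal coordinate has constant sign, which
    keeps the angle away from [pi / 2] there. *)
Lemma above_move X (lam : R -> R * R) (u v : R) : line X -> continuous lam ->
  (forall t, `|(lam t).1| <= 2) -> u <= v ->
  (forall t s, u <= t <= v -> lam t <> X s) ->
  above X (lam u) -> above X (lam v).
Proof.
move=> lX cl l1 uv lamX [p [cp ap p0 p5]]; have [cX _ _] := lX.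
pose V (q : R * R) := lam (q.2 + u) - X (q.1 - 5).
pose K := [set q : R * R | 0 <= q.1 <= 10 /\ 0 <= q.2 <= v - u].
have cV : continuous V.
  have cXq : continuous (fun q : R * R => X (q.1 - 5)).
    by apply: (comp_cont _ cX); cont.
  have clq : continuous (fun q : R * R => lam (q.2 + u)).
    by apply: (comp_cont _ cl); cont.
  by move=> q; apply: cvgB; [exact: clq|exact: cXq].
have star q r : K q -> 0 <= r <= 1 -> K (scale r q).
  case=> /andP[? ?] /andP[? ?] /andP[? ?].
  by split=> /=; apply/andP; split; nra.
have V0 q : K q -> V q <> 0.
  case=> _ /andP[? ?] /eqP; rewrite subr_eq0 => /eqP; apply: lamX.
  by apply/andP; split; lra.
have m5 : -5 <= (-5 : R) <= 5 by apply/andP; split; lra.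
have r5 : -5 <= (5 : R) <= 5 by apply/andP; split; lra.
have a0 : angle_of (p (-5)) (V 0) by rewrite /V add0r sub0r; exact: ap.
have [th [cth th0 ath]] := angle_lift cV (@box_compact R 0 10 0 (v - u)) star V0 a0.
have Kb (x y : R) : 0 <= x <= 10 -> 0 <= y <= v - u -> K (x, y) by [].
have aE s t : -5 <= s <= 5 -> 0 <= t <= v - u ->
    angle_of (th (s + 5, t)) (lam (t + u) - X s).
  move=> /andP[? ?] t0; have /ath : K (s + 5, t).
    by split=> //=; apply/andP; split; lra.
  by rewrite /V /= addrK.
have t0 : 0 <= (0 : R) <= v - u by apply/andP; split; lra.
have tv : 0 <= v - u <= v - u by apply/andP; split; lra.
have thc t : continuous (fun s : R => th (s + 5, t)).
  by apply: (comp_cont _ cth); cont.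
have E5 : th (5 + 5, 0) = p 5.
  have m55 : (-5 : R) <= 5 by lra.
  have := angle_unique_path m55 (continuous_subspaceT (thc 0))
    (continuous_subspaceT cp) _ ap.
  rewrite addNr -[(0, 0)]/(0 : R * R) th0 subrr => H.
  apply/eqP; rewrite -subr_eq0 H // => s s5.
  by have := aE s 0 s5 t0; rewrite add0r.
exists (fun s => th (s + 5, v - u)); split=> //.
- by move=> s s5; have := aE s _ s5 tv; rewrite subrK.
- rewrite addNr; apply: (@segment_below _ th 0) => //; last by rewrite th0.
  move=> t t01 /=; rewrite subrr mulr0 !add0r subr0.
  have tt : 0 <= t * (v - u) <= v - u.
    by case/andP: t01 => ? ?; apply/andP; split; nra.
  have := aE (-5) _ m5 tt; rewrite addNr => H.
  by apply: cos_gt0_neq; rewrite (angle_cos_gt0 H); exact: line_left.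
- apply: (@segment_above _ th (5 + 5, 0)) => //; last by rewrite E5.
  move=> t t01 /=; rewrite subrr mulr0 addr0 add0r subr0.
  have tt : 0 <= t * (v - u) <= v - u.
    by case/andP: t01 => ? ?; apply/andP; split; nra.
  apply: cos_lt0_neq; rewrite (angle_cos_lt0 (aE 5 _ r5 tt)); exact: line_right.
Qed.

Lemma aboveD X P w : above (fun s => X s + w) (P + w) = above X P.
Proof.
rewrite /above; apply/propext; split=> -[th [cth ath h1 h2]]; exists th; split=> //.
  by move=> s /ath; rewrite opprD addrACA subrr addr0.
by move=> s /ath; rewrite opprD addrACA subrr addr0.
Qed.

(** Far above the line the vector stays in the upper half-plane, where the angle
    is given by an arctangent. *)
Lemma above_far X : line X -> exists b : R, forall P, `|P.1| <= 2 -> b < P.2 ->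
  above X P.
Proof.
move=> lX; have [cX _ [b Xb]] := lX; exists b => P P1 P2.
have d0 s : 0 < (P - X s).2.
  by have := Xb s; rewrite ler_norml /= => /andP[? ?]; lra.
have cd : continuous (fun s => (P - X s).2) by rewrite /=; cont.
exists (fun s => pi / 2 - atan ((P - X s).1 / (P - X s).2)); split.
- apply: add_cont; first exact: cst_cont.
  apply: opp_cont; apply: (comp_cont (g := @atan R)); last exact: continuous_atan.
  by apply: div_cont => //=; [cont|move=> s; rewrite gt_eqF ?d0].
- move=> s _; set x := (P - X s).1 / _; have c0 := atan_cos_gt0 x.
  exists ((P - X s).2 / cos (atan x)); split; first by rewrite divr_gt0.
    rewrite cosB cos_pihalf sin_pihalf mul0r add0r mul1r sin_atanE.
    by rewrite mulrCA divfK ?gt_eqF // /x divfK ?gt_eqF.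
  by rewrite sinB cos_pihalf sin_pihalf mul0r subr0 mul1r divfK ?gt_eqF.
- rewrite gtrBl -atan0; apply: lt_atan; apply: divr_gt0 => //.
  exact: line_left.
- rewrite ltrBrDr gtrDl -atan0; apply: lt_atan.
  by rewrite ltr_pdivrMr // mul0r; exact: line_right.
Qed.

Lemma below_far X : line X -> exists b : R, forall P, `|P.1| <= 2 -> P.2 < b ->
  below X P.
Proof.
move=> /mirror_line/above_far[b Hb]; exists (- b) => P P1 P2.
by apply: Hb => //=; rewrite ltrNr.
Qed.

End Lines.

(** * Comparing two and three lines *)

Section Crossing.
Context {R : realType}.
Implicit Types (X Y Z : R -> R * R).

(** The parameters [s <= 0] and [s >= 0] are the two halves of a line. Only
    opposite halves of two lines are required to be disjoint: the left halves may
    cross each other, and so may the right halves. *)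
Definition apart X Y : Prop := forall s t, s * t <= 0 -> X s <> Y t.

Lemma apart_sym X Y : apart X Y -> apart Y X.
Proof. by move=> XY s t st YX; apply: (XY t s) => //; rewrite mulrC. Qed.

Lemma apart_mirror X Y : apart X Y ->
  apart (fun s => mirror (X s)) (fun s => mirror (Y s)).
Proof. by move=> XY s t st /(can_inj mirrorK); exact: XY. Qed.

(** The pairs of parameters at which two lines that are apart do not meet, cut to
    a size that contains the values of the parametrization by medians below. Not
    convex, but star-shaped, which is what lifting an angle requires. *)
Definition wedge : set (R * R) :=
  [set q | [/\ q.1 * q.2 <= 0, -15 <= q.1 <= 15 & -15 <= q.2 <= 15]].

Lemma wedge_compact : compact wedge.
Proof.
have cB := @box_compact R (-15) 15 (-15) 15.
apply: (subclosed_compact _ cB) => [|q []//].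
have -> : wedge = [set q : R * R | q.1 * q.2 <= 0] `&`
    [set q : R * R | -15 <= q.1 <= 15 /\ -15 <= q.2 <= 15].
  by apply/seteqP; split=> q; [case|case=> ? []].
apply: closedI; last by apply: compact_closed cB; exact: norm_hausdorff.
have cf : continuous (fun q : R * R => q.1 * q.2) by cont.
by have := closed_comp (fun x _ => cf x) (@closed_le R 0).
Qed.

Lemma wedge_sign (s t : R) : s * t <= 0 -> 5 <= t - s -> s <= 0 /\ 0 <= t.
Proof.
move=> st ts; split; rewrite leNgt; apply/negP => h.
  have : 0 < s * t by apply: mulr_gt0 => //; lra.
  by lra.
have : 0 < - s * - t by apply: mulr_gt0; lra.
by rewrite mulrNN; lra.
Qed.

(** The determination of the angle witnessing [above X (Y 0)] lives on the axis
    [t = 0] of the wedge and extends to all of it. Where [Y t] is far to the right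
    of [X s] (a convex part of the wedge) it is still less than [pi / 2]; where
    [Y t] is far to the left, it still exceeds [pi / 2]. *)
Lemma pair_angle X Y : line X -> line Y -> apart X Y -> above X (Y 0) ->
  exists A : R * R -> R, [/\ continuous A,
    forall s t, wedge (s, t) -> angle_of (A (s, t)) (Y t - X s),
    forall s t, wedge (s, t) -> 5 <= t - s -> A (s, t) < pi / 2
  & forall s t, wedge (s, t) -> 5 <= s - t -> pi / 2 < A (s, t)].
Proof.
move=> lX lY XY [p [cp ap p0 p5]].
have [cX _ _] := lX; have [cY _ _] := lY.
pose V (q : R * R) := Y q.2 - X q.1.
have cV : continuous V.
  have cXq : continuous (fun q : R * R => X q.1) by apply: (comp_cont _ cX); cont.
  have cYq : continuous (fun q : R * R => Y q.2) by apply: (comp_cont _ cY); cont.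
  by move=> q; apply: cvgB; [exact: cYq|exact: cXq].
have star q r : wedge q -> 0 <= r <= 1 -> wedge (scale r q).
  case=> q12 /andP[? ?] /andP[? ?] /andP[? ?].
  split=> /=; [|by apply/andP; split; nra|by apply/andP; split; nra].
  have -> : r * q.1 * (r * q.2) = r ^+ 2 * (q.1 * q.2) by ring.
  by rewrite mulr_ge0_le0 ?sqr_ge0.
have V0 q : wedge q -> V q <> 0.
  case=> q12 _ _ /eqP; rewrite subr_eq0 => /eqP E; exact: (XY _ _ q12 (esym E)).
have a0 : angle_of (p 0) (V 0) by apply: ap; apply/andP; split; lra.
have [A [cA A0 aA]] := angle_lift cV wedge_compact star V0 a0.
have axis s : -5 <= s <= 5 -> wedge (s, 0).
  by move=> /andP[? ?]; split=> /=; [rewrite mulr0|apply/andP; split; lra..].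
have cA0 : continuous (fun s : R => A (s, 0)) by apply: (comp_cont _ cA); cont.
have aA0 s : -5 <= s <= 5 -> angle_of (A (s, 0)) (Y 0 - X s).
  by move=> s5; exact: (aA _ (axis _ s5)).
have Al : A (-5, 0) = p (-5).
  have m0 : (-5 : R) <= 0 by lra.
  have := angle_unique_path (v := fun s => Y 0 - X s) m0
    (continuous_subspaceT cA0) (continuous_subspaceT cp).
  rewrite -[(0, 0)]/(0 : R * R) A0 subrr => H.
  apply/eqP; rewrite -subr_eq0 eq_sym; apply/eqP. apply: H => t /andP[? ?].
    by apply: aA0; apply/andP; split; lra.
  by apply: ap; apply/andP; split; lra.
have Ar : A (5, 0) = p 5.
  have m0 : 0 <= 5 :> R by lra.
  have := angle_unique_path (v := fun s => Y 0 - X s) m0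
    (continuous_subspaceT cA0) (continuous_subspaceT cp).
  rewrite -[(0, 0)]/(0 : R * R) A0 subrr => H.
  apply/eqP; rewrite -subr_eq0; apply/eqP; apply: H => t /andP[? ?].
    by apply: aA0; apply/andP; split; lra.
  by apply: ap; apply/andP; split; lra.
exists A; split=> //.
- by move=> s t w; exact: (aA (s, t) w).
- move=> s t [/= st /andP[? ?] /andP[? ?]] ts.
  have [s0 t0] := wedge_sign st ts.
  apply: (@segment_below _ A (-5, 0)) => //; last by rewrite Al.
  move=> r /andP[? ?] /=; rewrite subr0 add0r.
  have w : wedge (-5 + r * (s - -5), r * t).
    split=> /=; [|by apply/andP; split; nra|by apply/andP; split; nra].
    by apply: mulr_le0_ge0; nra.
  apply: cos_gt0_neq; rewrite (angle_cos_gt0 (aA _ w)) /=.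
  by apply: line_lt => //; nra.
- move=> s t [/= st /andP[? ?] /andP[? ?]] ts.
  have [t0 s0] : t <= 0 /\ 0 <= s by apply: wedge_sign; rewrite // mulrC.
  apply: (@segment_above _ A (5, 0)) => //; last by rewrite Ar.
  move=> r /andP[? ?] /=; rewrite subr0 add0r.
  have w : wedge (5 + r * (s - 5), r * t).
    split=> /=; [|by apply/andP; split; nra|by apply/andP; split; nra].
    by apply: mulr_ge0_le0; nra.
  apply: cos_lt0_neq; rewrite (angle_cos_lt0 (aA _ w)) /=.
  by apply: line_gt => //; nra.
Qed.

(** Both sides are read off one and the same function on the wedge, on its two
    axes. *)
Lemma above_below X Y : line X -> line Y -> apart X Y ->
  above X (Y 0) -> below Y (X 0).
Proof.
move=> lX lY XY aXY; have [A [cA aA near far]] := pair_angle lX lY XY aXY.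
have axis t : -5 <= t <= 5 -> wedge (0, t).
  by move=> /andP[? ?]; split=> /=; [rewrite mul0r|apply/andP; split; lra..].
apply/belowP; exists (fun t => A (0, t) - pi); split.
- have ct : continuous (fun t : R => (0 : R, t)) by cont.
  by apply: add_cont; [exact: (comp_cont ct cA)|exact: cst_cont].
- by move=> t /axis/aA/angleBpi; rewrite opprB.
- have : pi / 2 < A (0, -5).
    by apply: far; [apply: axis; apply/andP; split|]; lra.
  by lra.
- have : A (0, 5) < pi / 2.
    by apply: near; [apply: axis; apply/andP; split|]; lra.
  by lra.
Qed.

Lemma below_above X Y : line X -> line Y -> apart X Y ->
  below X (Y 0) -> above Y (X 0).
Proof.
move=> lX lY XY bXY; rewrite -below_mirror.
exact: (above_below (mirror_line lX) (mirror_line lY) (apart_mirror XY)).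
Qed.

(** The median of [2 * xi], [eta] and [- eta]. Subtracting it from the three
    numbers parametrizes, by a convex set, the triples of parameters with median
    zero. In such a triple any two entries have opposite signs, so the three lines
    are pairwise disjoint there. *)
Definition median (xi eta : R) : R :=
  clamp (- Num.max eta (- eta)) (Num.max eta (- eta)) (2 * xi).

Lemma nonpos_mul (u v : R) : u <= 0 <= v \/ v <= 0 <= u -> u * v <= 0.
Proof.
by case=> /andP[? ?]; [apply: mulr_le0_ge0|apply: mulr_ge0_le0].
Qed.

Lemma median_wedge (xi eta : R) : -5 <= xi <= 5 -> -5 <= eta <= 5 ->
  let m := median xi eta in
  [/\ wedge (2 * xi - m, eta - m), wedge (eta - m, - eta - m)
    & wedge (- eta - m, 2 * xi - m)].
Proof.
move=> /andP[? ?] /andP[? ?] /=.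
suff [h1 h2] : [/\ (2 * xi - median xi eta) * (eta - median xi eta) <= 0,
    (eta - median xi eta) * (- eta - median xi eta) <= 0
  & (- eta - median xi eta) * (2 * xi - median xi eta) <= 0] /\
    -5 <= median xi eta <= 5.
  case: h1 => ? ? ?; case/andP: h2 => ? ?.
  by split; split=> //=; apply/andP; split; lra.
rewrite /median; set w := Num.max eta (- eta).
have w0 : - w <= w.
  by rewrite /w; case: (leP eta (- eta)) => ?; lra.
have w5 : w <= 5 by rewrite /w ge_max; apply/andP; split; lra.
have wE : (w = eta /\ 0 <= eta) \/ (w = - eta /\ eta <= 0).
  by rewrite /w; case: (leP eta (- eta)) => ?; [right|left]; split=> //; lra.
split; last first.
  by have /andP[? ?] := clamp_itv (2 * xi) w0; apply/andP; split; lra.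
have key (m : R) : m = - w /\ 2 * xi <= - w \/ m = 2 * xi /\ - w <= 2 * xi <= w
    \/ m = w /\ w <= 2 * xi -> [/\ (2 * xi - m) * (eta - m) <= 0,
    (eta - m) * (- eta - m) <= 0 & (- eta - m) * (2 * xi - m) <= 0].
  case: wE => -[-> ?] [[-> ?]|[[-> /andP[? ?]]|[-> ?]]]; split; apply: nonpos_mul;
  first [by left; apply/andP; split; lra | by right; apply/andP; split; lra].
apply: key; have [lo|lo] := leP (2 * xi) (- w); first by left; rewrite clamp_le.
right; have [hi|hi] := leP w (2 * xi); first by right; rewrite clamp_ge.
by left; have h : - w <= 2 * xi <= w; rewrite ?clamp_id // !ltW.
Qed.

(** On the triples of median zero, let [al], [be], [ga] be the angles of [Y - X],
    [Z - Y] and [X - Z]. They are never all equal, because the three vectors add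
    up to zero. On the boundary some line is far to one side of another one, and
    cyclicity decides there which of two angles exceeds [pi / 2]:
    - on the left side, [X] is far to the left, so [al < pi / 2 < ga];
    - on the right side, [ga < pi / 2 < al];
    - on the upper side, [be] exceeds [pi / 2] and one of [al], [ga] does not;
    - on the lower side, [be] is less than [pi / 2] and one of [al], [ga] is not.
    The two-dimensional intermediate value theorem then produces a point where the
    three angles agree. *)
Lemma not_cyclic X Y Z : line X -> line Y -> line Z ->
  apart X Y -> apart Y Z -> apart Z X ->
  above X (Y 0) -> above Y (Z 0) -> above Z (X 0) -> False.
Proof.
move=> lX lY lZ XY YZ ZX.
move=> /(pair_angle lX lY XY)[a [ca aa near_a far_a]].
move=> /(pair_angle lY lZ YZ)[b [cb ab near_b far_b]].
move=> /(pair_angle lZ lX ZX)[g [cg ag near_g far_g]].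
pose m (q : R * R) := median (q.1 - 5) (q.2 - 5).
pose x (q : R * R) := 2 * (q.1 - 5) - m q.
pose y (q : R * R) := q.2 - 5 - m q.
pose z (q : R * R) := - (q.2 - 5) - m q.
have cm : continuous m by rewrite /m /median /clamp; cont.
pose al q := a (x q, y q); pose be q := b (y q, z q); pose ga q := g (z q, x q).
have cal : continuous al.
  have c : continuous (fun q => (x q, y q)) by rewrite /x /y; cont.
  exact: (comp_cont c ca).
have cbe : continuous be.
  have c : continuous (fun q => (y q, z q)) by rewrite /y /z; cont.
  exact: (comp_cont c cb).
have cga : continuous ga.
  have c : continuous (fun q => (z q, x q)) by rewrite /x /z; cont.
  exact: (comp_cont c cg).
have wE q : 0 <= q.1 <= 10 -> 0 <= q.2 <= 10 ->
    [/\ wedge (x q, y q), wedge (y q, z q) & wedge (z q, x q)].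
  by move=> /andP[? ?] /andP[? ?]; apply: median_wedge; apply/andP; split; lra.
pose lo q := Num.min (al q) (ga q); pose hi q := Num.max (al q) (ga q).
pose f q := al q - ga q.
(* The weights turn the comparison of [be] with the smaller of the two other
   angles, at the top, into that with the larger one, at the bottom; at a zero of
   [f] they do not matter. *)
pose h (q : R * R) :=
  be q - ((q.2 * 10^-1) * lo q + (1 - q.2 * 10^-1) * hi q).
have cf : continuous f by rewrite /f; cont.
have ch : continuous h by rewrite /h /lo /hi; cont.
have [||q [q1 q2 fq hq]] := @poincare_miranda R f h 10 _ cf ch.
- lra.
- move=> t t10; have /andP[? ?] := t10.
  have z10 : 0 <= (0 : R) <= 10 by apply/andP; split; lra.
  have m10 : 0 <= (10 : R) <= 10 by apply/andP; split; lra.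
  split.
  + have [w1 _ w3] := wE (0, t) z10 t10.
    have := near_a _ _ w1; have := far_g _ _ w3.
    rewrite -/(al (0, t)) -/(ga (0, t)) /f /x /y /z /= => A1 A2.
    have {}A1 := A1 ltac:(lra); have {}A2 := A2 ltac:(lra); lra.
  + have [w1 _ w3] := wE (10, t) m10 t10.
    have := far_a _ _ w1; have := near_g _ _ w3.
    rewrite -/(al (10, t)) -/(ga (10, t)) /f /x /y /z /= => A1 A2.
    have {}A1 := A1 ltac:(lra); have {}A2 := A2 ltac:(lra); lra.
  + have [w1 w2 w3] := wE (t, 0) t10 z10.
    have := near_b _ _ w2; have := far_a _ _ w1; have := far_g _ _ w3.
    rewrite -/(al (t, 0)) -/(be (t, 0)) -/(ga (t, 0)) /h /x /y /z /= => A1 A2 A3.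
    have {}A3 := A3 ltac:(lra).
    rewrite mul0r mul0r subr0 mul1r add0r subr_lt0 /hi lt_max.
    have [t5|t5] := leP 5 t.
      have {}A2 := A2 ltac:(lra); by rewrite (lt_trans A3 A2).
    have {}A1 := A1 ltac:(lra); by rewrite (lt_trans A3 A1) orbT.
  + have [w1 w2 w3] := wE (t, 10) t10 m10.
    have := far_b _ _ w2; have := near_a _ _ w1; have := near_g _ _ w3.
    rewrite -/(al (t, 10)) -/(be (t, 10)) -/(ga (t, 10)) /h /x /y /z /= => A1 A2 A3.
    have {}A3 := A3 ltac:(lra).
    rewrite divff ?pnatr_eq0 // mul1r subrr mul0r addr0 subr_gt0 /lo gt_min.
    have [t5|t5] := leP t 5.
      have {}A2 := A2 ltac:(lra); by rewrite (lt_trans A2 A3).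
    have {}A1 := A1 ltac:(lra); by rewrite (lt_trans A1 A3) orbT.
have eag : al q = ga q by apply/eqP; rewrite -subr_eq0 -/(f q) fq.
have ebg : be q = ga q.
  move: hq; rewrite /h /lo /hi eag minxx maxxx; lra.
have [w1 w2 w3] := wE q q1 q2.
have [r1 [r10 c1 s1]] := aa _ _ w1.
have [r2 [r20 c2 s2]] := ab _ _ w2.
have [r3 [r30 c3 s3]] := ag _ _ w3.
rewrite -/(al q) eag in c1 s1; rewrite -/(be q) ebg in c2 s2.
rewrite -/(ga q) in c3 s3.
have c0 : (r1 + r2 + r3) * cos (ga q) = 0.
  by rewrite !mulrDl -c1 -c2 -c3 /=; ring.
have s0 : (r1 + r2 + r3) * sin (ga q) = 0.
  by rewrite !mulrDl -s1 -s2 -s3 /=; ring.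
have r0 : r1 + r2 + r3 != 0 by rewrite gt_eqF // !addr_gt0.
have := cos2Dsin2 (ga q); move: c0 s0.
move=> /eqP; rewrite mulf_eq0 (negPf r0) /= => /eqP ->.
move=> /eqP; rewrite mulf_eq0 (negPf r0) /= => /eqP ->.
by rewrite expr0n addr0 => /eqP; rewrite eq_sym oner_eq0.
Qed.

End Crossing.

(** * Periodic families of lines *)

Section Deck.
Context {R : realType}.
Implicit Types (X Y Z : R -> R * R) (k j D : int).

Lemma below_move X (lam : R -> R * R) (u v : R) : line X -> continuous lam ->
  (forall t, `|(lam t).1| <= 2) -> u <= v ->
  (forall t s, u <= t <= v -> lam t <> X s) ->
  below X (lam u) -> below X (lam v).
Proof.
move=> lX cl l1 uv lamX.
apply: (@above_move _ _ (fun t => mirror (lam t))) => //.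
- exact: mirror_line.
- by rewrite /mirror; cont.
- by move=> t s /lamX + /(can_inj mirrorK) => /(_ s).
Qed.

Lemma above_moveE X (lam : R -> R * R) (u v : R) : line X -> continuous lam ->
  (forall t, `|(lam t).1| <= 2) -> u <= v ->
  (forall t s, u <= t <= v -> lam t <> X s) ->
  above X (lam u) <-> above X (lam v).
Proof.
move=> lX cl l1 uv lamX; split; first exact: above_move.
move=> av; have [//|bu] : above X (lam u) \/ below X (lam u).
  by apply: above_or_below => // s; apply: lamX; rewrite lexx.
by case: (above_not_below av); apply: below_move bu.
Qed.

(** The second coordinate will be an angle, so the deck transformations of the
    covering are these vertical translations. *)
Definition deck k : R * R := (0, 2 * pi * k%:~R).

Lemma deckD k j : deck (k + j) = deck k + deck j.
Proof. by rewrite /deck intrD mulrDr; congr pair; rewrite /= addr0. Qed.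

Lemma deckN k : deck (- k) = - deck k.
Proof. by rewrite /deck mulrNz mulrN; congr pair; rewrite /= oppr0. Qed.

Definition lift_of X k : R -> R * R := fun s => X s + deck k.

Lemma lift_line X k : line X -> line (lift_of X k).
Proof.
case=> cX X1 [b X2]; split.
- by move=> s; apply: cvgD; [exact: cX|exact: cvg_cst].
- by move=> s; rewrite /= addr0.
- exists (b + `|2 * pi * k%:~R|) => s /=.
  by rewrite (le_trans (ler_normD _ _)) // lerD2r.
Qed.

Lemma above_lift X k P : above (lift_of X k) P <-> above X (P - deck k).
Proof. by rewrite -[above X _](aboveD X _ (deck k)) subrK. Qed.

Lemma below_lift X k P : below (lift_of X k) P -> below X (P - deck k).
Proof.
rewrite /below /lift_of -(aboveD _ (mirror (P - deck k)) (mirror (deck k))).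
have mD v w : mirror (v + w) = mirror v + mirror w :> R * R.
  by congr pair; rewrite /= opprD.
rewrite -mD subrK; congr above; first by apply/funext => s; rewrite mD.
Qed.

Definition all_apart X Y : Prop := forall k s t, s * t <= 0 -> X s <> Y t + deck k.

Lemma all_apart_sym X Y : all_apart X Y -> all_apart Y X.
Proof.
move=> XY k s t st E; apply: (XY (- k) t s); first by rewrite mulrC.
by rewrite E deckN addrK.
Qed.

Lemma all_apart_lift X Y k j : all_apart X Y -> apart (lift_of X k) (lift_of Y j).
Proof.
move=> XY s t st E; apply: (XY (j - k) s t st).
by rewrite deckD deckN addrA -[Y t + _]/(lift_of Y j t) -E /lift_of addrK.
Qed.

Lemma above_lifts X Y k j :
  above (lift_of X k) (lift_of Y j 0) <-> above X (Y 0 + deck (j - k)).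
Proof. by rewrite above_lift /lift_of -addrA -deckN -deckD. Qed.

Lemma above_anti X Y k : line X -> line Y -> all_apart X Y ->
  above X (Y 0 + deck k) <-> ~ above Y (X 0 - deck k).
Proof.
move=> lX lY XY; have lYk := lift_line k lY.
have XYk : apart X (lift_of Y k) by move=> s t; exact: XY.
split=> [aX|naY].
  move=> /above_not_below; apply.
  exact: (below_lift (above_below lX lYk XYk aX)).
have [//|bX] : above X (lift_of Y k 0) \/ below X (lift_of Y k 0).
  apply: above_or_below => //; first exact: line_center lYk.
  by move=> s /esym; apply: XYk; rewrite mulr0.
by case: naY; apply/above_lift; exact: below_above.
Qed.

(** Translates of a point by large multiples of the period leave the bounded
    horizontal strip that contains the line. *)
Lemma above_farE X Y : line X -> line Y -> exists K : nat,
  forall n : nat, (K <= n)%N ->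
    above X (Y 0 + deck n) /\ ~ above X (Y 0 + deck (- n%:Z)).
Proof.
move=> lX lY; have [b Hb] := above_far lX; have [c Hc] := below_far lX.
have p0 : 1 <= 2 * pi :> R by have := @pi_ge2 R; lra.
exists (Num.trunc (Num.max (b - (Y 0).2) ((Y 0).2 - c))).+1 => n Kn.
have : Num.max (b - (Y 0).2) ((Y 0).2 - c) < n%:R.
  by rewrite (lt_le_trans (truncnS_gt _)) // ler_nat.
rewrite gt_max => /andP[n1 n2].
have nn : n%:R <= 2 * pi * n%:R :> R by rewrite ler_peMl.
split.
  by apply: Hb; rewrite /= ?addr0; [exact: line_center|rewrite -pmulrn; lra].
move=> /above_not_below; apply.
by apply: Hc; rewrite /= ?addr0; [exact: line_center|rewrite mulrNz -pmulrn; lra].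
Qed.

(** Since [G] and its complement are closed under addition, [G] contains the
    positive integers and misses the negative ones; so the jump of [G] is next to
    [0]. The symmetry exchanges the two sides of [- D / 2], which is therefore one
    half or minus one half. *)
Lemma sign_cut (G : int -> Prop) D (K : nat) :
  (forall k j, G k -> G j -> G (k + j)) ->
  (forall k j, ~ G k -> ~ G j -> ~ G (k + j)) ->
  (forall n : nat, (K <= n)%N -> G n%:Z /\ ~ G (- n%:Z)) ->
  (forall k, G (k - D) <-> ~ G (- k)) ->
  D = 1 \/ D = -1.
Proof.
move=> Gp Gn far sym.
have mulP k (n : nat) : G k -> G (k * n.+1%:Z).
  move=> Gk; elim: n => [|n IH]; rewrite ?mulr1 //.
  by rewrite -[n.+2]addn1 PoszD mulrDr mulr1; exact: Gp.
have mulN k (n : nat) : ~ G k -> ~ G (k * n.+1%:Z).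
  move=> Gk; elim: n => [|n IH]; rewrite ?mulr1 //.
  by rewrite -[n.+2]addn1 PoszD mulrDr mulr1; exact: Gn.
have posP k : 0 < k -> G k.
  move=> k0; apply: contrapT => nG; apply: (mulN k K nG).
  have -> : k * K.+1%:Z = (`|k|%N * K.+1)%N%:Z by lia.
  by have [] := far (`|k| * K.+1)%N _; first by nia.
have negN k : k < 0 -> ~ G k.
  move=> k0 kG; move: (mulP k K kG).
  have -> : k * K.+1%:Z = - (`|k|%N * K.+1)%N%:Z by lia.
  by have [] := far (`|k| * K.+1)%N _; first by nia.
have [G0|G0] := pselect (G 0).
  left; have nD : ~ G (- D) by have := sym 0; rewrite sub0r oppr0 => -> /(_ G0).
  have D0 : 0 < D.
    rewrite ltNge le_eqVlt; apply/negP => /orP[/eqP D0|D0].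
      by apply: nD; rewrite D0 oppr0.
    by apply: nD; apply: posP; lia.
  have G1 : G (1 - D) by apply/sym; apply: negN.
  have : ~ (1 - D < 0) by move=> /negN.
  lia.
right; have nD : G (- D) by have := sym 0; rewrite sub0r oppr0 => ->.
have D0 : D < 0.
  rewrite ltNge le_eqVlt; apply/negP => /orP[/eqP D0|D0].
    by apply: G0; move: nD; rewrite -D0 oppr0.
  by apply: (negN (- D)) => //; lia.
have G1 : ~ G (-1 - D) by move/sym; apply; rewrite opprK; exact: posP.
have : ~ (0 < -1 - D) by move=> /posP.
lia.
Qed.

(** Let [G k] say that [Y 0 + deck k] is above [X]. Moving along [lam] and
    antisymmetry express every relation between the three lines and their
    translates by [G], and show that the truth of [G] is reversed by the symmetry
    about [- D / 2]. The absence of cycles makes [G] and its complement closed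
    under addition. *)
Theorem deck_shift X Y Z (lam : R -> R * R) (t0 t1 t2 t3 : R) D :
  line X -> line Y -> line Z ->
  all_apart X Y -> all_apart Y Z -> all_apart X Z ->
  continuous lam -> (forall t, `|(lam t).1| <= 2) ->
  t0 <= t1 -> t1 <= t2 -> t2 <= t3 ->
  lam t0 = X 0 -> lam t1 = Y 0 -> lam t2 = Z 0 -> lam t3 = X 0 + deck D ->
  (forall k t s, t0 <= t <= t1 -> lam t + deck k <> Z s) ->
  (forall k t s, t1 <= t <= t2 -> lam t + deck k <> X s) ->
  (forall k t s, t2 <= t <= t3 -> lam t + deck k <> Y s) ->
  D = 1 \/ D = -1.
Proof.
move=> lX lY lZ XY YZ XZ cl l1 t01 t12 t23 e0 e1 e2 e3 aZ aX aY.
have move_k W (u v : R) k : line W -> u <= v ->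
    (forall k t s, u <= t <= v -> lam t + deck k <> W s) ->
    above W (lam u + deck k) <-> above W (lam v + deck k).
  move=> lW uv aW; apply: (@above_moveE W (fun t => lam t + deck k)) => //.
  - by move=> t; apply: cvgD; [exact: cl|exact: cvg_cst].
  - by move=> t; rewrite /= addr0.
  - by move=> t s; exact: aW.
pose G k := above X (Y 0 + deck k).
have XZG k : above X (Z 0 + deck k) <-> G k.
  by have := move_k X t1 t2 k lX t12 aX; rewrite e1 e2 /G => ->.
have YXG k : above Y (X 0 + deck k) <-> ~ G (- k).
  rewrite above_anti //; last exact: all_apart_sym.
  by rewrite -deckN.
have YZG k : above Y (Z 0 + deck k) <-> ~ G (- k - D).
  have := move_k Y t2 t3 k lY t23 aY; rewrite e2 e3 -addrA -deckD => ->.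
  by rewrite YXG opprD addrC.
have ZXG k : above Z (X 0 + deck k) <-> ~ G (- k).
  rewrite above_anti //; last exact: all_apart_sym.
  by rewrite -deckN XZG.
have ZYG k : above Z (Y 0 + deck k) <-> ~ G (- k).
  by have := move_k Z t0 t1 k lZ t01 aZ; rewrite e0 e1 => <-.
have sym k : G (k - D) <-> ~ G (- k).
  rewrite -ZYG above_anti //; last exact: all_apart_sym.
  by rewrite -deckN YZG opprK; split=> [h /(_ h)|/contrapT].
have YZG' k : above Y (Z 0 + deck k) <-> G k.
  by rewrite YZG sym opprK; split=> [/contrapT|h /(_ h)].
have [K far] := above_farE lX lY.
have above_base W k : above (lift_of W k) (X 0) <-> above W (X 0 + deck (- k)).
  by rewrite above_lift deckN.
have lYk k : line (lift_of Y k) by exact: lift_line.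
have lZk k : line (lift_of Z k) by exact: lift_line.
have XYk k : apart X (lift_of Y k) by move=> s t; exact: XY.
have XZk k : apart X (lift_of Z k) by move=> s t; exact: XZ.
have YZk k j : apart (lift_of Y k) (lift_of Z j) by exact: all_apart_lift.
apply: (@sign_cut G D K) => // k j Gk Gj.
- apply: contrapT => nG.
  apply: (@not_cyclic _ X (lift_of Y k) (lift_of Z (k + j))) => //.
  + exact/apart_sym.
  + by apply/above_lifts; rewrite [k + j]addrC addrK; exact/YZG'.
  + by apply/above_base/ZXG; rewrite opprK.
- move=> GG.
  apply: (@not_cyclic _ X (lift_of Z (k + j)) (lift_of Y k)) => //.
  + exact/apart_sym.
  + exact/apart_sym.
  + exact/XZG.
  + by apply/above_lifts/ZYG; rewrite opprB [k + j]addrC addrK.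
  + by apply/above_base/YXG; rewrite opprK.
Qed.

End Deck.

(** * The cyclic covering of the twice punctured plane *)

Section Cover.
Context {R : realType}.
Context (O O' : R * R) (OO' : O <> O').
Implicit Types (w z : R * R) (x y X Y : R -> R * R) (m M : R).

(** A bounded function of the ratio of the distances to [O] and [O'] serves as
    horizontal coordinate instead of its logarithm: unlike the logarithm it is
    continuous at [O] and [O']. *)
Definition rho z : R :=
  dot (z - O) (z - O) / (dot (z - O) (z - O) + dot (z - O') (z - O')).

Lemma dot_ge0 (v : R * R) : 0 <= dot v v.
Proof. by rewrite /dot -!expr2 addr_ge0 ?sqr_ge0. Qed.

Lemma neq_sub (z a : R * R) : z <> a -> z - a <> 0.
Proof. by move=> za /eqP; rewrite subr_eq0 => /eqP. Qed.

Lemma dist_sum_gt0 z : 0 < dot (z - O) (z - O) + dot (z - O') (z - O').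
Proof.
have [zO|zO] := pselect (z = O).
  by rewrite ltr_wpDl ?dot_ge0 // zO dot_gt0 //; exact: neq_sub.
by rewrite ltr_pwDl ?dot_ge0 // dot_gt0 //; exact: neq_sub.
Qed.

Lemma rho_itv z : 0 <= rho z <= 1.
Proof.
have d0 := dist_sum_gt0 z; rewrite /rho; apply/andP; split.
  by rewrite divr_ge0 ?dot_ge0 // ltW.
by rewrite ler_pdivrMr // mul1r lerDl dot_ge0.
Qed.

Lemma rho_gt0 z : z <> O -> 0 < rho z.
Proof.
by move=> zO; rewrite divr_gt0 ?dist_sum_gt0 // dot_gt0 //; exact: neq_sub.
Qed.

Lemma rhoO : rho O = 0.
Proof. by rewrite /rho subrr /dot /= !mul0r addr0 mul0r. Qed.

Lemma rhoO' : rho O' = 1.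
Proof.
have d0 := dot_gt0 (neq_sub (nesym OO')); rewrite /rho subrr.
have -> : dot 0 0 = 0 :> R by rewrite /dot /= !mul0r addr0.
by rewrite addr0 divff // gt_eqF.
Qed.

Lemma sub_cont (T : topologicalType) (f : T -> R * R) (a : R * R) :
  continuous f -> continuous (fun t => f t - a).
Proof. by move=> cf t; apply: cvgB; [exact: cf|exact: cvg_cst]. Qed.

Lemma rho_cont : continuous rho.
Proof.
have cO a : continuous (fun z : R * R => z - a) by exact/sub_cont/id_cont.
apply: div_cont; [exact: dot_cont| |by move=> z; rewrite gt_eqF ?dist_sum_gt0].
by apply: add_cont; exact: dot_cont.
Qed.

(** [w] lies over [z]: up to the monotone change of the first coordinate,
    [w] is a logarithm of [(z - O) / (z - O')]. *)
Definition lies_over w z : Prop := w.1 = rho z /\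
  exists p q, [/\ angle_of p (z - O), angle_of q (z - O') & w.2 = p - q].

Lemma angle_norm (t : R) (v : R * R) : angle_of t v ->
  exists r, [/\ 0 < r, v.1 = r * cos t, v.2 = r * sin t & dot v v = r ^+ 2].
Proof.
case=> r [r0 v1 v2]; exists r; split=> //.
by rewrite /dot v1 v2 -[RHS]mulr1 -(cos2Dsin2 t); ring.
Qed.

(** The coordinates give the modulus and the argument of the quotient of [z - O]
    by [z - O'], and this Moebius transformation is injective as [O <> O']. *)
Lemma over_inj w w' z z' (k : int) :
  lies_over w z -> lies_over w' z' -> w = w' + deck k -> z = z'.
Proof.
move=> [w1 [p [q [ap aq w2]]]] [w1' [p' [q' [ap' aq' w2']]]] ww'.
have rr : rho z = rho z' by rewrite -w1 -w1' ww' /= addr0.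
have pq : p + q' = (p' + q) + 2 * pi * k%:~R.
  have := congr1 snd ww'; rewrite /= w2 w2'; lra.
have c : cos (p + q') = cos (p' + q) by rewrite pq cosD2piz.
have s : sin (p + q') = sin (p' + q) by rewrite pq sinD2piz.
have [r [r0 u1 u2 ur]] := angle_norm ap; have [t [t0 v1 v2 vr]] := angle_norm aq.
have [r' [r0' u1' u2' ur']] := angle_norm ap'.
have [t' [t0' v1' v2' vr']] := angle_norm aq'.
have rt : r * t' = r' * t.
  have d1 : 0 < r ^+ 2 + t ^+ 2 by rewrite addr_gt0 ?exprn_gt0.
  have d2 : 0 < r' ^+ 2 + t' ^+ 2 by rewrite addr_gt0 ?exprn_gt0.
  have : (r * t') ^+ 2 = (r' * t) ^+ 2.
    move: rr; rewrite /rho ur vr ur' vr' => /eqP.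
    rewrite eqr_div ?(gt_eqF d1) ?(gt_eqF d2) // => /eqP; rewrite !exprMn; lra.
  by move/eqP; rewrite eqrXn2 ?mulr_ge0 ?ltW // => /eqP.
have e1 : (z - O).1 * (z' - O').1 - (z - O).2 * (z' - O').2 =
          (z' - O).1 * (z - O').1 - (z' - O).2 * (z - O').2.
  rewrite u1 u2 v1' v2' u1' u2' v1 v2.
  transitivity (r * t' * cos (p + q')); first by rewrite cosD; ring.
  by rewrite rt c cosD; ring.
have e2 : (z - O).1 * (z' - O').2 + (z - O).2 * (z' - O').1 =
          (z' - O).1 * (z - O').2 + (z' - O).2 * (z - O').1.
  rewrite u1 u2 v1' v2' u1' u2' v1 v2.
  transitivity (r * t' * sin (p + q')); first by rewrite sinD; ring.
  by rewrite rt s sinD; ring.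
have OO0 := dot_gt0 (neq_sub OO').
apply: contrapT => zz; have zz0 := dot_gt0 (neq_sub zz).
have := mulr_gt0 zz0 OO0.
(* As complex numbers, [(z - O) * (z' - O')] and [(z' - O) * (z - O')] are equal,
   that is, [(z - z') * (O - O')] is zero. *)
have -> : dot (z - z') (z - z') * dot (O - O') (O - O') =
   ((z - z').1 * (O - O').1 - (z - z').2 * (O - O').2) ^+ 2 +
   ((z - z').1 * (O - O').2 + (z - z').2 * (O - O').1) ^+ 2.
  by rewrite /dot; ring.
have -> : (z - z').1 * (O - O').1 - (z - z').2 * (O - O').2 = 0.
  by move: e1; rewrite /=; lra.
have -> : (z - z').1 * (O - O').2 + (z - z').2 * (O - O').1 = 0.
  by move: e2; rewrite /=; lra.
by rewrite expr0n addr0 ltxx.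
Qed.

Lemma over_exists z : z <> O -> z <> O' -> exists w, lies_over w z.
Proof.
move=> zO zO'; have [p ap] := angle_exists (neq_sub zO).
have [q aq] := angle_exists (neq_sub zO').
by exists (rho z, p - q); split=> //=; exists p, q.
Qed.

Lemma path_angle x (a : R * R) (c t0 : R) : 0 <= c -> continuous x ->
  (forall s, - c <= s <= c -> x s <> a) -> angle_of t0 (x 0 - a) ->
  exists p : R -> R, [/\ continuous p, p 0 = t0 &
    forall s, - c <= s <= c -> angle_of (p s) (x s - a)].
Proof.
move=> c0 cx xa at0; pose V (q : R * R) := x q.1 - a.
pose K := [set q : R * R | - c <= q.1 <= c /\ 0 <= q.2 <= 0].
have cV : continuous V by apply: sub_cont; apply: (comp_cont _ cx); cont.
have star q r : K q -> 0 <= r <= 1 -> K (scale r q).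
  case=> /andP[? ?] /andP[? ?] /andP[? ?].
  by split=> /=; apply/andP; split; nra.
have V0 q : K q -> V q <> 0 by case=> q1 _; exact/neq_sub/xa.
have [th [cth th0 ath]] := angle_lift cV (@box_compact R _ _ _ _) star V0 at0.
have cs : continuous (fun s : R => (s, 0 : R)) by cont.
exists (fun s => th (s, 0)); split=> //; first exact: (comp_cont cs cth).
by move=> s sc; apply: (ath (s, 0)); split=> //=; rewrite lexx.
Qed.

Lemma path_over x (c : R) w : 0 <= c -> continuous x ->
  (forall s, - c <= s <= c -> x s <> O /\ x s <> O') -> lies_over w (x 0) ->
  exists p q : R -> R, [/\ continuous p, continuous q,
    forall s, - c <= s <= c -> angle_of (p s) (x s - O),
    forall s, - c <= s <= c -> angle_of (q s) (x s - O')
  & w.2 = p 0 - q 0].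
Proof.
move=> c0 cx xO [w1 [p0 [q0 [ap aq w2]]]].
have [p [cp p00 pa]] := path_angle c0 cx (fun s sc => (xO s sc).1) ap.
have [q [cq q00 qa]] := path_angle c0 cx (fun s sc => (xO s sc).2) aq.
by exists p, q; split=> //; rewrite p00 q00.
Qed.

(** [X] is a lift of [x] on [[-1, 1]], with rays added at both ends to make it a
    line. The vertical lines at [m] and [M] keep the left ray away from the right
    halves, and the right ray away from the left halves. *)
Definition line_over m M x X : Prop :=
  [/\ line X, forall s, -1 <= s <= 1 -> lies_over (X s) (x s),
      forall s, s <= -1 -> (X s).1 < m, forall s, 1 <= s -> M < (X s).1
    & (forall s, 0 <= s <= 1 -> m < rho (x s)) /\
      (forall s, -1 <= s <= 0 -> rho (x s) < M)].

(** Outside [[-1, 1]] the path is frozen and the horizontal coordinate continues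
    at unit speed. *)
Lemma line_over_exists m M x w : continuous x ->
  (forall s, -1 <= s <= 1 -> x s <> O /\ x s <> O') -> lies_over w (x 0) ->
  rho (x (-1)) < m -> M < rho (x 1) ->
  (forall s, 0 <= s <= 1 -> m < rho (x s)) ->
  (forall s, -1 <= s <= 0 -> rho (x s) < M) ->
  exists X, line_over m M x X /\ X 0 = w.
Proof.
move=> cx xO w0 xm xM bm aM.
have c01 : 0 <= 1 :> R by lra.
have [p [q [cp cq ap aq w2]]] := path_over c01 cx xO w0.
have n1 : -1 <= 1 :> R by lra.
pose c := clamp (-1 : R) 1; have cc : continuous c by exact: clamp_cont.
have cI s : -1 <= c s <= 1 by exact: clamp_itv.
pose X s := (rho (x (c s)) + (s - c s), p (c s) - q (c s)).
have cpq : continuous (fun s => p s - q s) by cont.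
have XE s : -1 <= s <= 1 -> X s = (rho (x s), p s - q s).
  by move=> s1; rewrite /X /c clamp_id // subrr addr0.
exists X; split; last first.
  rewrite XE; last by apply/andP; split; lra.
  by case: w0 => w1 _; rewrite -w1 -w2 -surjective_pairing.
split; [split| | | |by split].
- apply: pair_cont.
    have crc : continuous (fun s => rho (x (c s))).
      exact: (comp_cont (comp_cont cc cx) rho_cont).
    by cont.
  exact: (comp_cont cc cpq).
- move=> s.
  have -> : (X s).1 - s = rho (x (c s)) - c s by rewrite /=; ring.
  have /andP[? ?] := rho_itv (x (c s)); have /andP[? ?] := cI s.
  by rewrite ler_norml; apply/andP; split; lra.
- have [u _ hu] := EVT_max n1 (continuous_subspaceT cpq).
  have [v _ hv] := EVT_min n1 (continuous_subspaceT cpq).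
  exists (`|p u - q u| + `|p v - q v|) => s /=.
  have cs : c s \in `[-1, 1] by rewrite in_itv /= cI.
  have := hu _ cs; have := hv _ cs.
  have := ler_norm (p u - q u); have := lerNnormlW (lexx `|p v - q v|).
  have := normr_ge0 (p u - q u); have := normr_ge0 (p v - q v).
  by move=> *; rewrite ler_norml; apply/andP; split; lra.
- move=> s s1; rewrite XE //; split=> //=; exists (p s), (q s).
  by split=> //; [exact: ap|exact: aq].
- move=> s s1; rewrite /X /c clamp_le //=; lra.
- move=> s s1; rewrite /X /c clamp_ge //=; lra.
Qed.

Lemma line_over_apart_half m M x X y Y (k : int) (s t : R) :
  line_over m M x X -> line_over m M y Y -> m < M ->
  (forall s t, -1 <= s <= 0 -> 0 <= t <= 1 -> x s <> y t) ->
  s <= 0 -> 0 <= t -> X s <> Y t + deck k.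
Proof.
move=> [_ oX lX rX [bX aX]] [_ oY lY rY [bY aY]] mM xy s0 t0 E.
have E1 : (X s).1 = (Y t).1 by rewrite E /= addr0.
have Yt : m < (Y t).1.
  have [t1|/ltW t1] := leP t 1; last by rewrite (lt_trans mM) // rY.
  have [-> _] : lies_over (Y t) (y t) by apply: oY; apply/andP; split; lra.
  by apply: bY; rewrite t0.
have Xs : (X s).1 < M.
  have [s1|/ltW s1] := leP (-1) s; last by rewrite (lt_trans _ mM) // lX.
  have [-> _] : lies_over (X s) (x s) by apply: oX; apply/andP; split; lra.
  by apply: aX; rewrite s1.
have [s1|/ltW s1] := leP (-1) s; last by have := lX s s1; lra.
have [t1|/ltW t1] := leP t 1; last by have := rY t t1; lra.
apply: (xy s t); rewrite ?s0 ?s1 ?t0 ?t1 //.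
apply: over_inj E; [apply: oX|apply: oY]; apply/andP; split; lra.
Qed.

Lemma line_over_apart m M x X y Y :
  line_over m M x X -> line_over m M y Y -> m < M ->
  (forall s t, -1 <= s <= 0 -> 0 <= t <= 1 -> x s <> y t) ->
  (forall s t, -1 <= s <= 0 -> 0 <= t <= 1 -> y s <> x t) ->
  all_apart X Y.
Proof.
move=> lx ly mM xy yx k s t st.
have [[s0 t0]|[s0 t0]] : (s <= 0 /\ 0 <= t) \/ (0 <= s /\ t <= 0).
- have [s0|s0] := ltP s 0.
    by left; split; [exact: ltW|rewrite -(nmulr_rle0 _ s0)].
  have [->|s1] := eqVneq s 0.
    by case: (leP 0 t) => ?; [left|right]; split=> //; exact: ltW.
  by right; split=> //; rewrite -(pmulr_rle0 _ (_ : 0 < s)) // lt_neqAle eq_sym s1.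
- exact: (line_over_apart_half lx ly).
- move=> E; apply: (line_over_apart_half (k := - k) ly lx mM yx t0 s0).
  by rewrite E deckN addrK.
Qed.

Lemma line_over_avoids m M x X (y lam : R -> R * R) (k : int) (s t : R) :
  line_over m M x X -> lies_over (lam t) (y t) -> m < rho (y t) < M ->
  (forall s, -1 <= s <= 1 -> y t <> x s) -> lam t + deck k <> X s.
Proof.
move=> [_ oX lX rX _] oy /andP[my yM] yx E.
have E1 : (lam t).1 = (X s).1 by rewrite -E /= addr0.
have ly : (lam t).1 = rho (y t) by case: oy.
have [s1|/ltW s1] := leP (-1) s; last by have := lX s s1; lra.
have [s2|/ltW s2] := leP s 1; last by have := rX s s2; lra.
have s12 : -1 <= s <= 1 by rewrite s1.
apply: (yx s s12); apply: (@over_inj _ _ _ _ (- k) oy (oX s s12)).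
by rewrite -E deckN addrK.
Qed.

End Cover.

(** * Winding numbers and the subdivided circle *)

Section Circle.
Context {R : realType}.
Implicit Types (l : R * R -> R * R) (A : R * R).

Lemma expi_cont : continuous (@expi R).
Proof. by apply: pair_cont => t; [exact: continuous_cos|exact: continuous_sin]. Qed.

Lemma expi_circle (t : R) : unit_circle R (expi t).
Proof. exact: cos2Dsin2. Qed.

Lemma expiD (t : R) (k : int) : expi (t + 2 * pi * k%:~R) = expi t.
Proof. by rewrite /expi cosD2piz sinD2piz. Qed.

Lemma expi_inj (s t : R) : expi s = expi t -> exists k : int, s = t + 2 * pi * k%:~R.
Proof.
case=> c d; have as_ : angle_of s (expi s) by exists 1; rewrite !mul1r ltr01.
have at_ : angle_of t (expi s) by exists 1; rewrite !mul1r ltr01 -c -d.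
by have [k E] := angle_unique as_ at_; exists k; rewrite -E addrC subrK.
Qed.

Lemma expi_neq (s t : R) : s < t -> t < s + 2 * pi -> expi s <> expi t.
Proof.
move=> st ts /expi_inj[k E]; have p0 : 0 < 2 * pi :> R by rewrite mulr_gt0 ?pi_gt0.
have : 0 < 2 * pi * (- k)%:~R :> R by rewrite mulrNz mulrN; lra.
have : 2 * pi * (- k)%:~R < 2 * pi * 1%:~R :> R by rewrite mulrNz mulrN; lra.
by rewrite ltr_pM2l // pmulr_rgt0 // ltr_int ltr0z; lia.
Qed.

Lemma curve_cont l : closed_curve l -> continuous (fun t : R => l (expi t)).
Proof.
move=> /subspace_continuousP cl t W nW; have nW' := cl _ (expi_circle t) W nW.
change (nbhs t (fun s : R => W (l (expi s)))).
have H := @expi_cont t _ nW'.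
by refine (@filterS _ (nbhs t) _ _ _ _ H) => s; apply; exact: expi_circle.
Qed.

Lemma angle_ofP (t : R) (A z : R * R) : angle_of t (z - A) <->
  exists r : R, 0 < r /\ z = (A.1 + r * cos t, A.2 + r * sin t).
Proof.
split=> -[r]; last by case=> r0 ->; exists r; rewrite /= ![_ + _ - _]addrC !addKr.
case=> r0 z1 z2; exists r; split=> //; rewrite -z1 -z2 /=.
by rewrite ![_ + (_ - _)]addrC !subrK -surjective_pairing.
Qed.

Lemma has_winding_number_unique l A (n k : int) :
  has_winding_number l A n -> has_winding_number l A k -> n = k.
Proof.
have p0 : 0 < 2 * pi :> R by rewrite mulr_gt0 ?pi_gt0.
move=> [p [cp ap pn]] [q [cq aq qk]].
have aP th : (forall t : R, t \in `[0, 2 * pi] -> exists r : R, 0 < r /\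
    l (expi t) = (A.1 + r * cos (th t), A.2 + r * sin (th t))) ->
    forall t, 0 <= t <= 2 * pi -> angle_of (th t) (l (expi t) - A).
  by move=> ath t t0; apply/angle_ofP/ath; rewrite in_itv.
have := angle_unique_path (ltW p0) cp cq (aP _ ap) (aP _ aq) => E.
have : 2 * pi * n%:~R = 2 * pi * k%:~R :> R by lra.
by move/(mulfI (lt0r_neq0 p0))/intr_inj.
Qed.

(** The definition starts at the angle [0]. The total variation over a period does
    not depend on the starting point [u], since it is a multiple of [2 * pi] that
    depends continuously on [u]. *)
Lemma winding_numberE l A (u : R) (p : R -> R) :
  closed_curve l -> ~ (l @` unit_circle R) A -> continuous p ->
  (forall t, 0 <= t <= 2 * pi -> angle_of (p t) (l (expi (t + u)) - A)) ->
  p (2 * pi) - p 0 = 2 * pi * (winding_number l A)%:~R.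
Proof.
move=> cl lA cp ap; have p0 : 0 < 2 * pi :> R by rewrite mulr_gt0 ?pi_gt0.
have cL := curve_cont cl; pose L t := l (expi t).
have LA t : L t <> A by move=> E; apply: lA; exists (expi t) => //; exact: expi_circle.
have [t0 at0] := angle_exists (neq_sub (LA 0)).
(* Both [[0, 2 * pi]] and the segment of length [2 * pi] from [u] lie in
   [[- c, c]]. *)
pose c := `|u| + 2 * pi.
have c0 : 0 <= c by rewrite addr_ge0 ?normr_ge0 ?ltW.
have [P [cP _ aP]] := path_angle c0 cL (fun s _ => LA s) at0.
have u1 := ler_norm u; have u2 := lerNnormlW (lexx `|u|); have u3 := normr_ge0 u.
have L2 t : L (t + 2 * pi) = L t.
  by have := expiD t 1; rewrite mulr1 /L => ->.
have aP1 t : - `|u| <= t <= `|u| -> angle_of (P (t + 2 * pi)) (L t - A).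
  move=> /andP[? ?]; rewrite -L2; apply: aP.
  by rewrite /c; apply/andP; split; lra.
have aP0 t : - `|u| <= t <= `|u| -> angle_of (P t) (L t - A).
  by move=> /andP[? ?]; apply: aP; rewrite /c; apply/andP; split; lra.
have cP2 : continuous (fun t : R => P (t + 2 * pi)).
  by apply: (comp_cont _ cP); cont.
have Pu : P (u + 2 * pi) - P u = P (0 + 2 * pi) - P 0.
  have [u0|u0] := leP 0 u.
    apply: (@angle_unique_path _ (fun t => P (t + 2 * pi)) P (fun t => L t - A)) => //.
    - exact: continuous_subspaceT.
    - exact: continuous_subspaceT.
    - by move=> t /andP[? ?]; apply: aP1; apply/andP; split; lra.
    - by move=> t /andP[? ?]; apply: aP0; apply/andP; split; lra.
  apply/esym.
  apply: (@angle_unique_path _ (fun t => P (t + 2 * pi)) P (fun t => L t - A)).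
  - exact: ltW.
  - exact: continuous_subspaceT.
  - exact: continuous_subspaceT.
  - by move=> t /andP[? ?]; apply: aP1; apply/andP; split; lra.
  - by move=> t /andP[? ?]; apply: aP0; apply/andP; split; lra.
have [n Pn] : exists n : int, P (0 + 2 * pi) - P 0 = 2 * pi * n%:~R.
  by apply: angle_unique (aP1 0 _) (aP0 0 _); apply/andP; split; lra.
have -> : winding_number l A = n.
  have Hn : has_winding_number l A n.
    exists P; split; [exact: continuous_subspaceT| |by rewrite -[2 * pi in LHS]add0r].
    move=> t; rewrite in_itv /= => /andP[? ?]; apply/angle_ofP/aP.
    by rewrite /c; apply/andP; split; lra.
  by apply: xget_unique => // k /has_winding_number_unique; apply.
have cPu : continuous (fun t : R => P (t + u)) by apply: (comp_cont _ cP); cont.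
have := @angle_unique_path _ p (fun t => P (t + u)) (fun t => L (t + u) - A)
  0 (2 * pi) (ltW p0) (continuous_subspaceT cp) (continuous_subspaceT cPu) ap.
move=> H; have {H} := H _; rewrite add0r [2 * pi + u]addrC => H.
suff : p (2 * pi) - P (u + 2 * pi) = p 0 - P u by lra.
apply: H => t /andP[? ?]; apply: aP; rewrite /c; apply/andP; split; lra.
Qed.

Lemma ord3_cases (i j k m : 'I_3) : i != j -> j != k -> k != i ->
  [\/ m = i, m = j | m = k].
Proof.
move=> ij jk ki; suff : (m == i) || (m == j) || (m == k).
  by case/orP => [/orP[]|] /eqP ->; [exact: Or31|exact: Or32|exact: Or33].
move: ij jk ki; rewrite -!val_eqE /=.
by case: i j k m => [[|[|[|i]]] ?] [[|[|[|j]]] ?] [[|[|[|k]]] ?] [[|[|[|m]]] ?].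
Qed.

(** Both arcs leave the point in the positive direction, so they share a short
    initial arc. *)
Lemma arcs_overlap_start (s t s' t' : R) (z : R * R) :
  s < t -> t < s + 2 * pi -> s' < t' -> expi s = expi s' ->
  (@expi R @` `[s, t]) `&` (@expi R @` `[s', t']) = [set z] -> z <> expi s.
Proof.
move=> st ts st' ss' I zs; have [k sk] := expi_inj ss'.
pose e := Num.min (t - s) (t' - s').
have e0 : 0 < e by rewrite lt_min !subr_gt0 st.
have [e1 e2] : e <= t - s /\ e <= t' - s' by rewrite !ge_min !lexx orbT.
have : [set z] (expi (s + e)).
  rewrite -I; split.
    by exists (s + e) => //=; rewrite in_itv /=; apply/andP; split; lra.
  exists (s' + e); first by rewrite /= in_itv /=; apply/andP; split; lra.
  by rewrite sk addrAC expiD.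
by rewrite /= zs => /esym; apply: expi_neq; lra.
Qed.

Lemma arcs_overlap_end (s t s' t' : R) (z : R * R) :
  s < t -> t < s + 2 * pi -> s' < t' -> expi t = expi t' ->
  (@expi R @` `[s, t]) `&` (@expi R @` `[s', t']) = [set z] -> z <> expi t.
Proof.
move=> st ts st' tt' I zt; have [k tk] := expi_inj tt'.
pose e := Num.min (t - s) (t' - s').
have e0 : 0 < e by rewrite lt_min !subr_gt0 st.
have [e1 e2] : e <= t - s /\ e <= t' - s' by rewrite !ge_min !lexx orbT.
have : [set z] (expi (t - e)).
  rewrite -I; split.
    by exists (t - e) => //=; rewrite in_itv /=; apply/andP; split; lra.
  exists (t' - e); first by rewrite /= in_itv /=; apply/andP; split; lra.
  by rewrite tk addrAC expiD.
by rewrite /= zt; apply: expi_neq; lra.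
Qed.

(** The arc after [c 0] cannot end where [c 0] ends, since two arcs meet in a single
    point, and similarly for the arc before it. Hence the three arcs follow each
    other in the positive direction. Together they make one turn and not two, for
    otherwise the last one would come back to the start of [c 0]. *)
Lemma circle_order (p : 'I_3 -> R * R) (c : 'I_3 -> set (R * R)) :
  splits_circle p c -> exists (a b : 'I_3) (u0 u1 u2 u3 : R),
  [/\ [/\ a != 0, b != 0 & a != b],
      [/\ u0 <= u1, u1 <= u2, u2 <= u3 & u3 = u0 + 2 * pi],
      [/\ p 0 = expi u0, p a = expi u1 & p b = expi u2]
    & [/\ forall t, u0 <= t <= u1 -> c b (expi t),
          forall t, u1 <= t <= u2 -> c 0 (expi t)
        & forall t, u2 <= t <= u3 -> c a (expi t)]].
Proof.
case=> arcs _ meet.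
have ends k : exists s t : R, [/\ s < t, t < s + 2 * pi, c k = @expi R @` `[s, t] &
    [/\ exists2 j, j != k & p j = expi s, exists2 j, j != k & p j = expi t
      & forall j, j != k -> p j = expi s \/ p j = expi t]].
  have [s [t [st ts ck E]]] := arcs k; exists s, t; split=> //; split.
  - have : [set expi s; expi t] (expi s) by left.
    by rewrite E => -[j jk pj]; exists j.
  - have : [set expi s; expi t] (expi t) by right.
    by rewrite E => -[j jk pj]; exists j.
  - move=> j jk; have : [set p j | j in [set j | j != k]] (p j) by exists j.
    by rewrite -E => -[]; [left|right].
have p_inj i j k : i != j -> j != k -> k != i -> p i <> p j.
  move=> ij jk ki pij; have [s [t [st ts _ [[i' i'k pi'] [j' j'k pj'] _]]]] := ends k.
  apply: (expi_neq st ts); rewrite -pi' -pj'.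
  have pE m : m != k -> p m = p i.
    by move=> mk; have [->|->//|E] := ord3_cases m ij jk ki; rewrite // E eqxx in mk.
  by rewrite !pE.
have [s0 [t0 [st0 ts0 c0 [[a a0 pa] [b b0 pb] _]]]] := ends 0.
have ab : a != b.
  by apply/eqP => E; apply: (expi_neq st0 ts0); rewrite -pa -pb E.
have ba : b != a by rewrite eq_sym.
have a0' : 0 != a by rewrite eq_sym.
have b0' : 0 != b by rewrite eq_sym.
have [s1 [t1 [st1 ts1 cb [_ _ eb]]]] := ends b.
have [s2 [t2 [st2 ts2 ca [_ _ ea]]]] := ends a.
have pat1 : p a = expi t1.
  have [E|//] := eb a ab; exfalso.
  have := meet 0 b a b0' ba a0; rewrite c0 cb.
  by move=> /(arcs_overlap_start st0 ts0 st1 _); apply; rewrite -?pa.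
have p0s1 : p 0 = expi s1.
  by have [//|E] := eb 0 b0'; case: (p_inj 0 a b a0' ab b0); rewrite E pat1.
have pbs2 : p b = expi s2.
  have [//|E] := ea b ba; exfalso.
  have := meet 0 a b a0' ab b0; rewrite c0 ca.
  by move=> /(arcs_overlap_end st0 ts0 st2 _); apply; rewrite -?pb.
have p0t2 : p 0 = expi t2.
  by have [E|//] := ea 0 a0'; case: (p_inj 0 b a b0' ba a0); rewrite E pbs2.
have [k1 E1] : exists k : int, t1 = s0 + 2 * pi * k%:~R by apply: expi_inj; rewrite -pat1.
have [k2 E2] : exists k : int, s2 = t0 + 2 * pi * k%:~R by apply: expi_inj; rewrite -pbs2.
pose u0 := s1 + (s0 - t1); pose u3 := t2 + (t0 - s2).
have u0E t : expi (t + (s0 - t1)) = expi t.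
  by rewrite -[RHS](expiD _ (- k1)) mulrNz mulrN; congr expi; lra.
have u3E t : expi (t + (t0 - s2)) = expi t.
  by rewrite -[RHS](expiD _ (- k2)) mulrNz mulrN; congr expi; lra.
have cbE t : u0 <= t <= s0 -> c b (expi t).
  move=> /andP[h1 h2]; rewrite cb; exists (t - (s0 - t1)); last by rewrite -u0E subrK.
  by rewrite /u0 in h1; rewrite /= in_itv /=; apply/andP; split; lra.
have caE t : t0 <= t <= u3 -> c a (expi t).
  move=> /andP[h1 h2]; rewrite ca; exists (t - (t0 - s2)); last by rewrite -u3E subrK.
  by rewrite /u3 in h2; rewrite /= in_itv /=; apply/andP; split; lra.
have p0 : 0 < 2 * pi :> R by rewrite mulr_gt0 ?pi_gt0.
have [n nE] : exists n : int, u3 = u0 + 2 * pi * n%:~R.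
  by apply: expi_inj; rewrite u3E u0E -p0t2.
have n0 : 0 < n.
  have : 0 < 2 * pi * n%:~R :> R by rewrite /u3 /u0 in nE; lra.
  by rewrite pmulr_rgt0 // ltr0z.
have n2 : n < 2.
  rewrite ltNge; apply/negP => n2; apply: (p_inj a b 0 ab b0 a0').
  have : 2 * pi * 2%:~R <= 2 * pi * n%:~R :> R by rewrite ler_pM2l // ler_int.
  move=> h; have ca_pa : c a (p a).
    rewrite pa -(expiD _ 1) mulr1; apply: caE; rewrite /u3 /u0 in nE *.
    by apply/andP; split; lra.
  have c0_pa : c 0 (p a).
    by rewrite c0 pa; exists s0 => //=; rewrite in_itv /= lexx ltW.
  by have : (c 0 `&` c a) (p a) by []; rewrite (meet 0 a b a0' ab b0).
have n1 : n = 1 by clear -n0 n2; lia.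
exists a, b, u0, s0, t0, u3; split=> //.
- split; [rewrite /u0; lra|exact: ltW|rewrite /u3; lra|by rewrite nE n1 mulr1].
- by split=> //; rewrite u0E.
- split=> // t /andP[? ?]; rewrite c0; exists t => //=.
  by rewrite in_itv /=; apply/andP.
Qed.

End Circle.

(** * Lines from the given arcs *)

Section Arcs.
Context {R : realType}.
Implicit Types (P Q A : R * R) (S : set (R * R)).

Lemma arc_compact S P Q : is_arc S P Q -> compact S.
Proof.
by case=> f [cf _ _ _ ->]; apply: continuous_compact => //; exact: segment_compact.
Qed.

Lemma rho_lower S (O O' : R * R) : O <> O' -> compact S -> ~ S O ->
  exists m, 0 < m /\ forall z, S z -> m < rho O O' z.
Proof.
move=> OO' cS SO; have [S0|S0] := pselect (S !=set0); last first.
  by exists 1; split=> // z Sz; case: S0; exists z.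
have [z zS zm] := compact_EVT_min S0 cS (continuous_subspaceT (rho_cont OO')).
rewrite inE in zS; exists (rho O O' z / 2).
have r0 : 0 < rho O O' z by apply: rho_gt0 => // E; rewrite E in zS.
split; first by rewrite divr_gt0.
by move=> y Sy; have := zm y; rewrite inE => /(_ Sy); lra.
Qed.

Lemma rho_swap (O O' z : R * R) : O <> O' -> rho O' O z = 1 - rho O O' z.
Proof.
move=> OO'; have := dist_sum_gt0 OO' z; rewrite /rho addrC => d0.
by field; rewrite gt_eqF.
Qed.

Lemma rho_upper S (O O' : R * R) : O <> O' -> compact S -> ~ S O' ->
  exists M, M < 1 /\ forall z, S z -> rho O O' z < M.
Proof.
move=> OO' cS SO; have [m [m0 mS]] := rho_lower (nesym OO') cS SO.
exists (1 - m); split; first lra.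
by move=> z /mS; rewrite rho_swap //; lra.
Qed.

(** The part of an arc from [O] to [A] that comes after some point close to
    [O], parametrized by [[-1, 0]]. *)
Lemma arc_tail S (O O' : R * R) A m :
  O <> O' -> is_arc S O A -> 0 < m -> m < rho O O' A ->
  exists x : R -> R * R, [/\ continuous x, forall s, 0 <= s -> x s = A,
    rho O O' (x (-1)) < m & forall s, S (x s) /\ x s <> O].
Proof.
move=> OO' [f [cf fi f0 f1 ->]] m0 mA.
have l01 : 0 <= 1 :> R by lra.
pose F t := f (clamp 0 1 t).
have cF : continuous F by exact: within_clamp_cont.
have cr : continuous (fun t => rho O O' (F t)) by exact: (comp_cont cF (rho_cont OO')).
have F0 : F 0 = O by rewrite /F clamp_id ?f0 // lexx l01.
have F1 : F 1 = A by rewrite /F clamp_id ?f1 // lexx l01.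
have [|t] := IVT (v := m / 2) l01 (continuous_subspaceT cr).
  rewrite F0 F1 rhoO // ge_min le_max; apply/andP; split; apply/orP; [left|right]; lra.
rewrite in_itv /= => /andP[t0 t1] ft.
have t0' : 0 < t.
  rewrite lt_neqAle t0 andbT; apply/eqP => E; move: ft; rewrite -E F0 rhoO //; lra.
pose h (s : R) := 1 + (1 - t) * clamp (-1) 0 s.
have n10 : -1 <= 0 :> R by lra.
have hI s : t <= h s <= 1.
  have /andP[? ?] := clamp_itv s n10; rewrite /h; apply/andP; split; nra.
have ch : continuous h by rewrite /h /clamp; cont.
exists (fun s => F (h s)); split.
- exact: (comp_cont ch cF).
- by move=> s s0; rewrite /h clamp_ge // mulr0 addr0.
- have -> : h (-1) = t by rewrite /h clamp_le //; ring.
  by rewrite ft; lra.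
move=> s; have /andP[h1 h2] := hI s.
have hs : h s \in `[0, 1] by rewrite in_itv /= h2 andbT (le_trans t0).
have FE : F (h s) = f (h s) by rewrite /F clamp_id // h2 andbT (le_trans t0).
rewrite FE; split; first by exists (h s).
rewrite -f0 => /fi E; have : h s = 0 by apply: E => //; rewrite in_itv /= lexx l01.
lra.
Qed.

(** The two tails are glued by adding them up, each being constant on the
    half-line where the other one moves. *)
Lemma arcs_line SO SO' (O O' : R * R) A m M w :
  O <> O' -> is_arc SO O A -> is_arc SO' O' A ->
  0 < m -> M < 1 -> m < rho O O' A < M -> lies_over O O' w A ->
  (forall z, SO z -> rho O O' z < M) -> (forall z, SO' z -> m < rho O O' z) ->
  exists x X : R -> R * R, [/\ line_over O O' m M x X, X 0 = w,
    forall s, s <= 0 -> SO (x s) & forall s, 0 <= s -> SO' (x s)].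
Proof.
move=> OO' aO aO' m0 M1 /andP[mA AM] wA SOM SOm.
have [a [ca a1 am aS]] := arc_tail OO' aO m0 mA.
have M0 : 0 < 1 - M by lra.
have AM' : 1 - M < rho O' O A by rewrite rho_swap //; lra.
have [b [cb b1 bM bS]] := arc_tail (nesym OO') aO' M0 AM'.
pose x s := a s + b (- s) - A.
have cx : continuous x.
  apply: sub_cont => s; apply: cvgD; first exact: ca.
  have cn : continuous (fun s : R => - s) by cont.
  exact: (comp_cont cn cb).
have xl s : s <= 0 -> x s = a s by move=> s0; rewrite /x b1 ?addrK // oppr_ge0.
have xr s : 0 <= s -> x s = b (- s).
  by move=> s0; rewrite /x a1 // addrC addrA addNr add0r.
have xSO s : s <= 0 -> SO (x s) by move=> s0; rewrite xl //; case: (aS s).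
have xSO' s : 0 <= s -> SO' (x s) by move=> s0; rewrite xr //; case: (bS (- s)).
have x0 : x 0 = A by rewrite xl // a1.
have xO s : x s <> O /\ x s <> O'.
  have [s0|/ltW s0] := leP s 0; split=> E.
  - by have [_] := aS s; rewrite -xl.
  - by have := SOM _ (xSO s s0); rewrite E rhoO' //; lra.
  - by have := SOm _ (xSO' s s0); rewrite E rhoO //; lra.
  - by have [_] := bS (- s); rewrite -xr.
have [||||||X [lX X0]] := @line_over_exists _ O O' OO' m M x w cx.
- by move=> s _.
- by rewrite x0.
- by rewrite xl //; lra.
- by rewrite xr //; move: bM; rewrite rho_swap //; lra.
- by move=> s /andP[s0 _]; apply/SOm/xSO'.
- by move=> s /andP[_ s0]; apply/SOM/xSO.
by exists x, X.
Qed.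

End Arcs.

Theorem theorem1p2 (R : realType) (l : R * R -> R * R)
    (p : 'I_3 -> R * R) (c : 'I_3 -> set (R * R)) (A : 'I_3 -> R * R)
    (O O' : R * R) (OA O'A : 'I_3 -> set (R * R)) :
  closed_curve l ->
  splits_circle p c ->
  (forall i, A i = l (p i)) ->
  (forall i, ~ (l @` c i) (A i)) ->
  ~ (l @` unit_circle R) O ->
  ~ (l @` unit_circle R) O' ->
  (forall i, is_arc (OA i) O (A i)) ->
  (forall i, is_arc (O'A i) O' (A i)) ->
  (forall i, (OA i `|` O'A i) `&` (l @` c i) = set0) ->
  (forall i j, i != j -> OA i `&` O'A j = set0) ->
  winding_number l O - winding_number l O' = 1 \/
  winding_number l O - winding_number l O' = -1.
Proof.
move=> cl sc Al _ lO lO' aO aO' lX OO'A.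
have [a [b [u0 [u1 [u2 [u3 [[a0 b0 ab] [u01 u12 u23 u3E] [p0 pa pb] [cb c0 ca]]]]]]]] :=
  circle_order sc.
have cL := curve_cont cl; pose L t := l (expi t).
have pi2 : 0 < 2 * pi :> R by rewrite mulr_gt0 ?pi_gt0.
have disj i j z : i != j -> OA i z -> O'A j z -> False.
  by move=> ij zi zj; have : (OA i `&` O'A j) z by []; rewrite OO'A.
have OAO i : OA i O.
  by have [f [_ _ f0 _ ->]] := aO i; exists 0 => //=; rewrite in_itv /= lexx ler01.
have O'AO i : O'A i O'.
  by have [f [_ _ f0 _ ->]] := aO' i; exists 0 => //=; rewrite in_itv /= lexx ler01.
have OO' : O <> O' by move=> E; apply: (disj a 0 O a0) => //; rewrite E.
have other i : exists j : 'I_3, j != i.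
  have [->|ia] := eqVneq i a; first by exists 0; rewrite eq_sym.
  by exists a; rewrite eq_sym.
pose U := L @` `[u0, u3].
have cU : compact U.
  apply: continuous_compact; [exact: continuous_subspaceT|exact: segment_compact].
have UO t : u0 <= t <= u3 -> U (L t) by move=> tu; exists t => //=; rewrite in_itv.
have nUO z : ~ (l @` unit_circle R) z -> ~ U z.
  by move=> nz [t _ E]; apply: nz; exists (expi t) => //; exact: expi_circle.
have cover3 (F : 'I_3 -> set (R * R)) : (forall i, compact (F i)) ->
    compact (U `|` (F 0 `|` (F a `|` F b))).
  by move=> cF; do 3 apply: compactU => //.
have in3 (F : 'I_3 -> set (R * R)) i z : F i z -> (F 0 `|` (F a `|` F b)) z.
  have a0' : 0 != a by rewrite eq_sym.
  by have [->|->|->] := ord3_cases i a0' ab b0 => Fz; [left|right; left|right; right].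
have not3 (F : 'I_3 -> set (R * R)) z : ~ U z -> (forall i, ~ F i z) ->
    ~ (U `|` (F 0 `|` (F a `|` F b))) z.
  by move=> nU nF [//|[/nF//|[/nF//|/nF//]]].
(* The curve and the arcs at [O'] stay away from [O], the curve and the arcs at
   [O] stay away from [O']: this gives the levels at which the arcs at [O] and [O']
   can be cut and continued by rays. *)
have [m [m0 mS]] : exists m, 0 < m /\
    forall z, (U `|` (O'A 0 `|` (O'A a `|` O'A b))) z -> m < rho O O' z.
  apply: rho_lower => //; first by apply: cover3 => i; exact: arc_compact (aO' i).
  apply: not3 => [|j Oj]; first exact: nUO.
  by have [i ij] := other j; exact: (disj i j O).
have [M [M1 MS]] : exists M, M < 1 /\
    forall z, (U `|` (OA 0 `|` (OA a `|` OA b))) z -> rho O O' z < M.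
  apply: rho_upper => //; first by apply: cover3 => i; exact: arc_compact (aO i).
  apply: not3 => [|j Oj]; first exact: nUO.
  by have [i ij] := other j; apply: (disj j i O') => //; rewrite eq_sym.
have mUM z : U z -> m < rho O O' z < M.
  by move=> Uz; rewrite mS ?MS //; left.
have LO t : L t <> O /\ L t <> O'.
  by split=> E; [apply: lO|apply: lO']; exists (expi t) => //; exact: expi_circle.
pose x t := L (t + u0).
have cx : continuous x.
  have ct : continuous (fun t : R => t + u0) by cont.
  exact: (comp_cont ct cL).
have [w0 ow0] := over_exists (LO (0 + u0)).1 (LO (0 + u0)).2.
have [P [Q [cP cQ aP aQ _]]] :=
  path_over (ltW pi2) cx (fun s _ => LO (s + u0)) ow0.
pose lam t := (rho O O' (x t), P t - Q t).
have cl_lam : continuous lam.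
  have cr := comp_cont cx (rho_cont OO').
  by rewrite /lam; cont.
have olam t : 0 <= t <= 2 * pi -> lies_over O O' (lam t) (x t).
  move=> /andP[t0 t2]; split=> //; exists (P t), (Q t).
  by split=> //; [apply: aP|apply: aQ]; apply/andP; split; lra.
have Ux t : 0 <= t <= 2 * pi -> U (x t).
  by move=> /andP[? ?]; apply: UO; apply/andP; split; lra.
pose t1 := u1 - u0; pose t2 := u2 - u0.
have x0 : x 0 = A 0 by rewrite /x add0r Al p0.
have x1 : x t1 = A a by rewrite /x /t1 subrK Al pa.
have x2 : x t2 = A b by rewrite /x /t2 subrK Al pb.
have t0I : 0 <= (0 : R) <= 2 * pi by apply/andP; split; lra.
have t1I : 0 <= t1 <= 2 * pi by rewrite /t1; apply/andP; split; lra.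
have t2I : 0 <= t2 <= 2 * pi by rewrite /t2; apply/andP; split; lra.
have lines i t : 0 <= t <= 2 * pi -> x t = A i ->
    exists y Y, [/\ line_over O O' m M y Y, Y 0 = lam t,
      forall s, s <= 0 -> OA i (y s) & forall s, 0 <= s -> O'A i (y s)].
  move=> tI xA; apply: (@arcs_line _ (OA i) (O'A i) O O' (A i)) => //.
  - by rewrite -xA; exact/mUM/Ux.
  - by rewrite -xA; exact: olam.
  - by move=> z Oz; apply: MS; right; exact: in3 Oz.
  - by move=> z Oz; apply: mS; right; exact: in3 Oz.
have [y0 [Y0 [l0 Y00 y0l y0r]]] := lines 0 0 t0I x0.
have [ya [Ya [la Ya0 yal yar]]] := lines a t1 t1I x1.
have [yb [Yb [lb Yb0 ybl ybr]]] := lines b t2 t2I x2.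
have mM : m < M by have /andP[] := mUM _ (Ux _ t0I); exact: lt_trans.
have apart_lines i j yi Yi yj Yj : i != j ->
    line_over O O' m M yi Yi -> line_over O O' m M yj Yj ->
    (forall s, s <= 0 -> OA i (yi s)) -> (forall s, 0 <= s -> O'A i (yi s)) ->
    (forall s, s <= 0 -> OA j (yj s)) -> (forall s, 0 <= s -> O'A j (yj s)) ->
    all_apart Yi Yj.
  move=> ij li lj il ir jl jr; apply: (line_over_apart OO' li lj mM).
    move=> s t /andP[_ s0] /andP[t0 _] E.
    by apply: (disj i j (yi s)) => //; [exact: il|rewrite E; exact: jr].
  move=> s t /andP[_ s0] /andP[t0 _] E.
  by apply: (disj j i (yj s)); [rewrite eq_sym|exact: jl|rewrite E; exact: ir].
have avoid i yi Yi k t s : line_over O O' m M yi Yi ->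
    (forall s, s <= 0 -> OA i (yi s)) -> (forall s, 0 <= s -> O'A i (yi s)) ->
    0 <= t <= 2 * pi -> c i (expi (t + u0)) -> lam t + deck k <> Yi s.
  move=> li il ir tI ci; apply: (line_over_avoids OO' li (olam t tI) (mUM _ (Ux t tI))).
  move=> r _ E; have : ((OA i `|` O'A i) `&` (l @` c i)) (x t).
    split; last by exists (expi (t + u0)).
    by rewrite E; have [r0|/ltW r0] := leP r 0; [left; exact: il|right; exact: ir].
  by rewrite lX.
(* [lam] runs through [c b], [c 0] and [c a] in this order, starting over [A 0]. *)
apply: (@deck_shift _ Y0 Ya Yb lam 0 t1 t2 (2 * pi)) => //.
- by case: l0.
- by case: la.
- by case: lb.
- by apply: (apart_lines 0 a y0 Y0 ya Ya); rewrite // eq_sym.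
- exact: (apart_lines a b ya Ya yb Yb).
- by apply: (apart_lines 0 b y0 Y0 yb Yb); rewrite // eq_sym.
- move=> t; rewrite /lam /=; have /andP[? ?] := rho_itv OO' (x t).
  by rewrite ler_norml; apply/andP; split; lra.
- by case/andP: t1I.
- by rewrite /t1 /t2; lra.
- by case/andP: t2I.
- rewrite Y00 /lam; congr pair.
    by rewrite /= addr0 /x add0r addrC -u3E {1}u3E /L -[2 * pi]mulr1 (expiD _ 1).
  have hP : P (2 * pi) - P 0 = 2 * pi * (winding_number l O)%:~R.
    apply: (winding_numberE (u := u0) cl lO cP) => t /andP[? ?].
    by apply: aP; apply/andP; split; lra.
  have hQ : Q (2 * pi) - Q 0 = 2 * pi * (winding_number l O')%:~R.
    apply: (winding_numberE (u := u0) cl lO' cQ) => t /andP[? ?].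
    by apply: aQ; apply/andP; split; lra.
  by rewrite /= intrD mulrNz; lra.
- move=> k t s /andP[h0 h1]; case/andP: t1I => ? ?.
  apply: (avoid b yb Yb) => //; first by apply/andP; split; lra.
  by apply: cb; rewrite /t1 in h1; apply/andP; split; lra.
- move=> k t s /andP[h0 h1]; case/andP: t1I => ? ?; case/andP: t2I => ? ?.
  apply: (avoid 0 y0 Y0) => //; first by apply/andP; split; lra.
  by apply: c0; rewrite /t1 in h0; rewrite /t2 in h1; apply/andP; split; lra.
- move=> k t s /andP[h0 h1]; case/andP: t2I => ? ?.
  apply: (avoid a ya Ya) => //; first by apply/andP; split; lra.
  by apply: ca; rewrite /t2 in h0; apply/andP; split; lra.
Qed.
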